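(* Fix a downwards-closed constraint $\mathcal{F}\subseteq 2^{[n]}$ and let $\mathrm{B}$ be a semi-online selection algorithm with $\mathrm{Val}_{\mathcal{F},\mathcal{D}}(\mathrm{B})\ge\alpha^{-1}\,\mathrm{ExAnte}(\mathcal{F},\mathcal{D})$ for every product distribution $\mathcal{D}$ on $\mathbb{R}^n$. Then there exists a committing policy $\mathcal{T}_{\mathrm{B}}$ such that $\mathrm{Util}_{\mathbbm{I}}(\mathcal{T}_{\mathrm{B}})\ge\alpha^{-1}\,\mathrm{OPT}(\mathbbm{I})$ for every CICS instance $\mathbbm{I}=(\mathcal{F},\mathbb{M})$.
   Context: Costly Information Combinatorial Selection (CICS): an instance $\mathbbm{I}=(\mathcal{F},\mathbb{M})$ consists of a downwards-closed $\mathcal{F}\subseteq 2^{[n]}$ and $n$ Markov decision processes $\mathbb{M}=(\mathcal{M}_1,\dots,\mathcal{M}_n)$. Each $\mathcal{M}_i$ has a finite state set $\Omega_i$, root state $\sigma_i$, for each state $s$ a set of actions $A_i(s)$ with nonnegative costs $c_i(a)$, and for each action $a\in A_i(s)$ a transition distribution $\Pi_i(s,a)$ over $\Omega_i$; the transition graph is acyclic, the sink states form the terminal set $T_i$, and each terminal $t$ has a value $v_i(t)\ge 0$. A policy starts with state vector $(\sigma_1,\dots,\sigma_n)$ and repeatedly (adaptively, possibly randomly) either picks $i$ with $s_i$ non-terminal and an action $a\in A_i(s_i)$, pays $c_i(a)$ and moves $\mathcal{M}_i$ to a random state drawn from $\Pi_i(s_i,a)$; or halts by selecting a set $S\in\mathcal{F}$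 with $S\subseteq\{i: s_i\in T_i\}$, collecting $\sum_{i\in S}v_i(s_i)$. Its utility $\mathrm{Util}_{\mathbbm{I}}(\mathcal{T})$ is expected collected value minus expected total action cost; $\mathrm{OPT}(\mathbbm{I})$ is the maximum utility over all policies. A commitment is a tuple $(\pi_1,\dots,\pi_n)$ where $\pi_i$ maps each state $s$ of $\mathcal{M}_i$ to a distribution over $A_i(s)$; a policy commits to it if, whenever it advances $\mathcal{M}_i$ from state $s$, the action is drawn from $\pi_i(s)$ (the choice of which MDP to advance and when to halt may still be adaptive). A committing policy is a policy that commits to some commitment. Bayesian Combinatorial Selection: $\mathcal{P}(\mathcal{F})$ is the convex hull of indicator vectors of sets in $\mathcal{F}$; for a distribution $D$ on $\mathbb{R}$ and $q\in[0,1]$, $F_D(q)$ is the expectation of a draw from $D$ conditioned on lying in its top $q$ quantile (splitting point masses as needed); for a product distribution $\mathcal{D}=D_1\times\cdots\times D_n$, $\mathrm{ExAnte}(\mathcal{F},\mathcal{D})=\max_{q\in\mathcal{P}(\mathcal{F})}\sum_i q_iF_{D_i}(q_i)$. A semi-online selection algorithm starts with $S=\emptyset$ and iteratively chooses (adaptively, possibly repeating indices) an index $i\notin S$ with $S\cup\{i\}\in\mathcal{F}$ and a threshold $\tau_i$; it observes only whether $x_i\ge\tau_i$, and if so it must set $S:=S\cup\{i\}$; it stops when no index can be chosen or it halts. $\mathrm{Val}_{\mathcal{F},\mathcal{D}}(\mathrm{B})$ is the expected value of the final set's total $\sum_{i\in S}x_i$ with $x\sim\mathcal{D}$. *)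

(* Defs.v *)
From HB Require Import structures.
From mathcomp Require Import all_boot all_order all_algebra.
From mathcomp Require Import boolp classical_sets reals.
Set Implicit Arguments. Unset Strict Implicit. Unset Printing Implicit Defensive.
Import Order.TTheory GRing.Theory Num.Theory.
Local Open Scope ring_scope.

Definition downward_closed (n : nat) (F : {set {set 'I_n}}) : Prop :=
  forall S T : {set 'I_n}, S \in F -> T \subset S -> T \in F.

Record mdp (R : realType) := MDP {
  st : finType;
  act : finType;
  root : st;
  avail : st -> act -> bool;
  cost : st -> act -> R;
  trans : st -> act -> st -> R;
  tval : st -> R }.

Definition tedge (R : realType) (M : mdp R) : rel (st M) :=
  fun s s' => [exists a, avail s a && (0 < trans s a s')].

Definition terminal (R : realType) (M : mdp R) (s : st M) : bool :=
  [forall a, ~~ avail s a].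

Definition wf_mdp (R : realType) (M : mdp R) : Prop :=
  (forall (s : st M) a, avail s a -> 0 <= cost s a) /\
  (forall (s : st M) a, avail s a ->
     (forall s', 0 <= trans s a s') /\ \sum_(s' : st M) trans s a s' = 1) /\
  (forall s s', tedge s s' -> ~~ connect (@tedge _ M) s' s) /\
  (forall s : st M, terminal s -> 0 <= tval s).

Definition wf_instance (R : realType) (n : nat) (M : 'I_n -> mdp R) : Prop :=
  forall i, wf_mdp (M i).

(* One step of a history: index i advanced, action taken, resulting state *)
Definition step (R : realType) (n : nat) (M : 'I_n -> mdp R) : Type :=
  {i : 'I_n & (act (M i) * st (M i))%type}.

Definition cur (R : realType) (n : nat) (M : 'I_n -> mdp R)
  (h : seq (step M)) : forall i, st (M i) :=
  foldl (fun (f : forall i, st (M i)) (e : step M) =>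
           dfwith f (projT2 e).2) (fun i => root (M i)) h.

(* A (possibly randomised, adaptive) policy, given behaviourally: after
   history h it halts selecting S with probability [haltp h S], and
   advances M_i with action a with probability [advp h i a]. *)
Record policy (R : realType) (n : nat) (M : 'I_n -> mdp R) := Policy {
  haltp : seq (step M) -> {set 'I_n} -> R;
  advp : seq (step M) -> forall i, act (M i) -> R }.
Arguments haltp {R n M} p h S.
Arguments advp {R n M} p h i a.

Definition valid_policy (R : realType) (n : nat) (F : {set {set 'I_n}})
  (M : 'I_n -> mdp R) (T : policy M) : Prop :=
  (forall h S, 0 <= haltp T h S) /\
  (forall h i a, 0 <= advp T h i a) /\
  (forall h, \sum_(S : {set 'I_n}) haltp T h S
             + \sum_(i < n) \sum_(a : act (M i)) advp T h i a = 1) /\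
  (forall h S, 0 < haltp T h S ->
     S \in F /\ (forall i, i \in S -> terminal (cur h i))) /\
  (forall h i a, 0 < advp T h i a -> avail (cur h i) a).

Fixpoint run_util (R : realType) (n : nat) (M : 'I_n -> mdp R)
  (T : policy M) (k : nat) (h : seq (step M)) : R :=
  \sum_(S : {set 'I_n}) haltp T h S * \sum_(i in S) tval (cur h i)
  + if k is k'.+1 then
      \sum_(i < n) \sum_(a : act (M i)) advp T h i a *
        (- cost (cur h i) a
         + \sum_(s' : st (M i)) trans (cur h i) a s' *
             run_util T k' (rcons h (existT _ i (a, s'))))
    else 0.

(* By acyclicity every run makes fewer than \sum_i #|st (M i)| advances,
   so this fuel computes the exact expected utility. *)
Definition Util (R : realType) (n : nat) (M : 'I_n -> mdp R) (T : policy M) : R :=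
  run_util T (\sum_(i < n) #|{: st (M i)}|) [::].

Definition OPT (R : realType) (n : nat) (F : {set {set 'I_n}})
  (M : 'I_n -> mdp R) : R :=
  sup [set u | exists T : policy M, valid_policy F T /\ u = Util T].

Definition commitment (R : realType) (n : nat) (M : 'I_n -> mdp R)
  (pi : forall i, st (M i) -> act (M i) -> R) : Prop :=
  forall i (s : st (M i)), ~~ terminal s ->
    (forall a, 0 <= pi i s a) /\ (forall a, 0 < pi i s a -> avail s a) /\
    \sum_(a : act (M i)) pi i s a = 1.

(* T commits to pi: whenever it advances M_i from state s, the action is
   drawn from pi i s (the choice of i / halting remains adaptive). *)
Definition commits_to (R : realType) (n : nat) (M : 'I_n -> mdp R)
  (T : policy M) (pi : forall i, st (M i) -> act (M i) -> R) : Prop :=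
  forall h i a,
    advp T h i a = (\sum_(b : act (M i)) advp T h i b) * pi i (cur h i) a.

Definition committing (R : realType) (n : nat) (M : 'I_n -> mdp R)
  (T : policy M) : Prop :=
  exists pi, commitment pi /\ commits_to T pi.

(* a finitely supported distribution on R: list of (atom, probability) *)
Definition fdist (R : realType) := seq (R * R).

Definition is_fdist (R : realType) (d : fdist R) : Prop :=
  (forall e, e \in d -> 0 <= e.2) /\ \sum_(e <- d) e.2 = 1.

Definition Pmass (R : realType) (d : fdist R) (v : R) : R :=
  \sum_(e <- d | e.1 == v) e.2.
Definition Pgt (R : realType) (d : fdist R) (v : R) : R :=
  \sum_(e <- d | v < e.1) e.2.

(* F_D(q): expectation of a draw conditioned on its top q quantile,
   splitting point masses: the mass taken at atom v is
   min(P(X=v), max(0, q - P(X>v))). (For q = 0 this is 0, which only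
   ever appears multiplied by q.) *)
Definition Ftop (R : realType) (d : fdist R) (q : R) : R :=
  q^-1 * \sum_(v <- undup (map fst d))
           v * Num.min (Pmass d v) (Num.max (q - Pgt d v) 0).

Definition in_hull (R : realType) (n : nat) (F : {set {set 'I_n}})
  (q : 'I_n -> R) : Prop :=
  exists lam : {set 'I_n} -> R,
    (forall S, 0 <= lam S) /\ (forall S, S \notin F -> lam S = 0) /\
    \sum_(S : {set 'I_n}) lam S = 1 /\
    (forall i, q i = \sum_(S : {set 'I_n} | i \in S) lam S).

Definition ExAnte (R : realType) (n : nat) (F : {set {set 'I_n}})
  (D : 'I_n -> fdist R) : R :=
  sup [set u | exists q : 'I_n -> R,
                 in_hull F q /\ u = \sum_(i < n) q i * Ftop (D i) (q i)].

(* A deterministic semi-online algorithm: given the history of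
   (index, threshold, outcome [x_i >= tau]) it either halts (None) or
   proposes the next index and threshold. *)
Definition salg (R : realType) (n : nat) : Type :=
  seq ('I_n * R * bool) -> option ('I_n * R).

Definition Sof (R : realType) (n : nat) (h : seq ('I_n * R * bool)) : {set 'I_n} :=
  [set i | has (fun e : 'I_n * R * bool => (e.1.1 == i) && e.2) h].

(* one step of the algorithm on realisation x; a proposal violating
   (i \notin S and S + i \in F) is treated as halting, as is None *)
Definition sstep (R : realType) (n : nat) (F : {set {set 'I_n}})
  (x : 'I_n -> R) (A : salg R n) (h : seq ('I_n * R * bool)) :
  seq ('I_n * R * bool) :=
  match A h with
  | Some (i, tau) =>
      if (i \notin Sof h) && (i |: Sof h \in F)
      then rcons h (i, tau, tau <= x i) else h
  | None => h
  end.

(* final selected set (the selected set only grows, at most n times) *)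
Definition final_set (R : realType) (n : nat) (F : {set {set 'I_n}})
  (x : 'I_n -> R) (A : salg R n) : {set 'I_n} :=
  [set i | `[< exists N : nat, i \in Sof (iter N (sstep F x A) [::]) >]].

Definition Val (R : realType) (n : nat) (F : {set {set 'I_n}})
  (D : 'I_n -> fdist R) (A : salg R n) : R :=
  \sum_(j : {dffun forall i : 'I_n, 'I_(size (D i))})
     (\prod_(i < n) (nth (0, 0) (D i) (j i)).2) *
     \sum_(i in final_set F (fun k => (nth (0, 0) (D k) (j k)).1) A)
        (nth (0, 0) (D i) (j i)).1.

(* Main.v *)
Require Import Defs.
From HB Require Import structures.
From mathcomp Require Import all_boot all_order all_algebra.
From mathcomp Require Import reals.
From mathcomp Require Import boolp ring lra.
Import Order.TTheory GRing.Theory Num.Theory.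
Local Open Scope ring_scope.

Set Implicit Arguments.
Unset Strict Implicit.
Unset Printing Implicit Defensive.

(** Take an optimal policy [T], and let the commitment play action [a] at state
    [s] with the conditional frequency with which [T] does. Each MDP becomes a
    Markov chain; give every state [s] the index at which paying the cost of
    moving on is exactly compensated by the expected excess of later indices over
    it. The smallest index met along a trajectory is the surrogate value of the
    chain, with law [D_i]. For every price [t], the expected excess of the
    surrogate over [t] dominates what [T] earns from chain [i] at price [t] per
    selection; taking for [t] the quantile at the selection probability of [T]
    yields [OPT <= ExAnte F D]. Conversely, a query [x_i >= tau] of the algorithm
    is simulated by advancing chain [i] until it finishes or its running minimum
    falls below [tau]. A chain whose indices stay above the threshold is always
    selected, so no excess over the index is ever lost and the simulation earns
    [Val F D (B D)]. *)

(** * Finitely supported distributions *)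

Section FiniteDistributions.
Variable R : realType.
Implicit Types (d : fdist R) (x y z : R) (g : R -> R).

Definition pos x := Num.max x 0.

Lemma pos_ge0 x : 0 <= pos x. Proof. by rewrite le_max lexx orbT. Qed.

Lemma pos_ge x : x <= pos x. Proof. by rewrite le_max lexx. Qed.

Lemma pos_id x : 0 <= x -> pos x = x. Proof. by move=> ?; apply/max_idPl. Qed.

Lemma pos_eq0 x : x <= 0 -> pos x = 0. Proof. by move=> ?; apply/max_idPr. Qed.

Lemma le_pos x y : x <= y -> pos x <= pos y.
Proof. by move=> xy; rewrite ge_max pos_ge0 (le_trans xy (pos_ge y)). Qed.

Lemma posD x y : 0 <= y -> pos (x + y) <= pos x + y.
Proof. by move=> y0; rewrite ge_max lerD2r pos_ge addr_ge0 ?pos_ge0. Qed.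

(* The identity behind amortization: capping [y] at [s] lowers its excess over
   [m] by exactly the excess of [y] over [s], once [m] is capped as well. *)
Lemma pos_min (m s y : R) :
  pos (Num.min s y - m) = pos (y - Num.min m s) - pos (y - s).
Proof.
have [ms|sm] := leP m s; last first.
  by rewrite subrr pos_eq0 // subr_le0 ge_min (ltW sm).
have [sy|ys] := leP s y.
  rewrite !pos_id ?subr_ge0 //; last exact: le_trans ms sy.
  by ring.
by rewrite (@pos_eq0 (y - s)) ?subr0 // subr_le0 ltW.
Qed.

Lemma pos_min_ge (m s y : R) :
  pos (y - m) - pos (y - s) <= pos (Num.min s y - m).
Proof.
by rewrite pos_min lerB // le_pos // lerB // ge_min lexx.
Qed.

Lemma seq_argmin (s : seq R) (p : pred R) : has p s ->
  exists2 x, (x \in s) && p x & forall y, y \in s -> p y -> x <= y.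
Proof.
elim: s => //= a s IH; case: (boolP (has p s)) => [/IH [x /andP[xs px] xmin] _|].
  case: (boolP (p a && (a <= x))) => [/andP[pa ax]|pax].
    exists a; first by rewrite mem_head pa.
    move=> y; rewrite inE => /orP[/eqP->//|ys py].
    exact: le_trans ax (xmin _ ys py).
  exists x; first by rewrite inE xs orbT px.
  move=> y; rewrite inE => /orP[/eqP-> pa|]; last exact: xmin.
  by move: pax; rewrite pa /= -ltNge => /ltW.
move=> /hasPn np; rewrite orbF => pa; exists a; first by rewrite mem_head pa.
by move=> y; rewrite inE => /orP[/eqP->//|/np /negP].
Qed.

Lemma seq_argmax (s : seq R) (p : pred R) : has p s ->
  exists2 x, (x \in s) && p x & forall y, y \in s -> p y -> y <= x.
Proof.
move=> sp; have : has (fun x => p (- x)) [seq - x | x <- s].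
  by rewrite has_map; apply: sub_has sp => x /=; rewrite opprK.
move=> /seq_argmin [_ /andP[/mapP[x xs ->]]]; rewrite opprK => px xmin.
exists x; first by rewrite xs px.
by move=> y ys py; rewrite -lerN2 xmin ?opprK // map_f.
Qed.

Definition fexp d g : R := \sum_(e <- d) e.2 * g e.1.

Lemma eq_fexp d g g' : (forall e, e \in d -> g e.1 = g' e.1) ->
  fexp d g = fexp d g'.
Proof. by move=> gg'; apply: eq_big_seq => e /gg' ->. Qed.

Lemma le_fexp d g g' : is_fdist d -> (forall e, e \in d -> g e.1 <= g' e.1) ->
  fexp d g <= fexp d g'.
Proof.
move=> [d0 _] gg'; rewrite /fexp big_seq [leRHS]big_seq; apply: ler_sum => e ed.
by rewrite ler_wpM2l ?d0 ?gg'.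
Qed.

Lemma fexp_ge0 d g : is_fdist d -> (forall e, e \in d -> 0 <= g e.1) ->
  0 <= fexp d g.
Proof.
move=> [d0 _] g0; rewrite /fexp big_seq; apply: sumr_ge0 => e ed.
by rewrite mulr_ge0 ?d0 ?g0.
Qed.

Lemma fexpD d g g' : fexp d (fun x => g x + g' x) = fexp d g + fexp d g'.
Proof. by rewrite -big_split; apply: eq_bigr => e _; rewrite mulrDr. Qed.

Lemma fexpB d g g' : fexp d (fun x => g x - g' x) = fexp d g - fexp d g'.
Proof. by rewrite -sumrB; apply: eq_bigr => e _; rewrite mulrBr. Qed.

Lemma fexpM d c g : fexp d (fun x => c * g x) = c * fexp d g.
Proof. by rewrite mulr_sumr; apply: eq_bigr => e _; rewrite mulrCA. Qed.

Lemma fexp_cst d c : is_fdist d -> fexp d (fun=> c) = c.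
Proof. by move=> [_ d1]; rewrite /fexp -mulr_suml d1 mul1r. Qed.

Lemma fexp0 d g : (forall e, e \in d -> g e.1 = 0) -> fexp d g = 0.
Proof. by move=> g0; rewrite /fexp big_seq big1 // => e /g0 ->; rewrite mulr0. Qed.

Definition excess d z := fexp d (fun x => pos (x - z)).

Lemma excess_ge0 d z : is_fdist d -> 0 <= excess d z.
Proof. by move=> dd; apply: fexp_ge0 => // e _; exact: pos_ge0. Qed.

Lemma excess_eq0 d z : (forall e, e \in d -> e.1 <= z) -> excess d z = 0.
Proof. by move=> dz; apply: fexp0 => e /dz ez; rewrite pos_eq0 // subr_le0. Qed.

Lemma fdist_bounded d : exists B : R, 0 <= B /\ forall e, e \in d -> `|e.1| <= B.
Proof.
exists (\sum_(e <- d) `|e.1|); split; first by apply: sumr_ge0.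
move=> e ed; rewrite (big_rem e) //= lerDl; exact: sumr_ge0.
Qed.

(** The excess is nonincreasing and 1-Lipschitz in [z], at least [c] at [- B - c] and zero from [B]
    on. For [c > 0] it therefore takes the value [c] at the supremum of the points where it is at
    least [c]. *)
Lemma excess_surj d c : is_fdist d -> 0 <= c -> exists z, excess d z = c.
Proof.
move=> dd c0; have [B [B0 dB]] := fdist_bounded d.
pose E := (fun z => c <= excess d z) : classical_sets.set R.
have lip z e : 0 <= e -> excess d z <= excess d (z + e) + e.
  move=> e0; rewrite -[X in _ + X](fexp_cst e dd) -fexpD; apply: le_fexp => // x _.
  have -> : x.1 - z = x.1 - (z + e) + e by ring.
  exact: posD.
have mono z z' : z <= z' -> excess d z' <= excess d z.
  by move=> zz'; apply: le_fexp => // x _; rewrite le_pos // lerB.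
(* For [c = 0] the set [E] is the whole line and unbounded; any point above all atoms serves
   instead. *)
have [c_eq0|cn0] := eqVneq c 0.
  exists B; rewrite c_eq0 excess_eq0 // => e /dB; exact: le_trans (ler_norm _).
have cgt0 : 0 < c by rewrite lt_neqAle eq_sym cn0.
have EB z : E z -> z <= B.
  move=> Ez; rewrite leNgt; apply/negP => Bz; move: Ez.
  rewrite /E excess_eq0 ?leNgt ?cgt0 // => e /dB eB.
  exact: le_trans (le_trans (ler_norm _) eB) (ltW Bz).
have E0 : E (- B - c).
  rewrite /E -[X in X <= _](fexp_cst c dd); apply: le_fexp => // e /dB.
  rewrite ler_norml => /andP[eB _]; apply: le_trans (pos_ge _); lra.
have hs : classical_sets.has_sup E by split; [exists (- B - c)|exists B].
pose s := sup E; exists s; apply/eqP; rewrite eq_le; apply/andP; split.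
  apply/ler_addgt0Pr => e e0; apply: le_trans (lip s e (ltW e0)) _.
  rewrite lerD2r leNgt; apply/negP => /ltW Ese.
  by have := sup_upper_bound hs Ese; rewrite -/s; lra.
apply/ler_addgt0Pr => e e0; have [z Ez sz] := sup_adherent e0 hs.
apply: le_trans Ez _; apply: le_trans (mono _ _ (ltW sz)) _.
by have := lip (s - e) e (ltW e0); rewrite subrK.
Qed.

(** * Quantiles and the top-quantile functional *)

Lemma Pmass_ge0 d x : is_fdist d -> 0 <= Pmass d x.
Proof.
by move=> [d0 _]; rewrite /Pmass big_seq_cond; apply: sumr_ge0 => e /andP[/d0].
Qed.

Lemma PmassE d x : Pmass d x = fexp d (fun y => (y == x)%:R).
Proof.
by rewrite /Pmass big_mkcond; apply: eq_bigr => e _; case: eqP; rewrite ?mulr1 ?mulr0.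
Qed.

Lemma PgtE d x : Pgt d x = fexp d (fun y => (x < y)%R%:R).
Proof.
by rewrite /Pgt big_mkcond; apply: eq_bigr => e _; case: ifP; rewrite ?mulr1 ?mulr0.
Qed.

Lemma sum_Pmass d g (Z : seq R) : uniq Z -> (forall e, e \in d -> e.1 \in Z) ->
  \sum_(x <- Z) g x * Pmass d x = fexp d g.
Proof.
move=> uZ dZ; under eq_bigr do rewrite PmassE mulr_sumr.
rewrite exchange_big; apply: eq_big_seq => e ed.
rewrite (bigD1_seq e.1) ?dZ //= eqxx mulr1 mulrC big1 ?addr0 // => x xe.
by rewrite eq_sym (negbTE xe) !mulr0.
Qed.

Lemma Pgt_ge0 d x : is_fdist d -> 0 <= Pgt d x.
Proof. by move=> dd; rewrite PgtE; apply: fexp_ge0 => // e _; rewrite ler0n. Qed.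

(** The integral of the upper tail of mass [q]: it is [q * Ftop d q] freed of the division, and so
    also covers [q = 0]. *)
Definition top_sum d (q : R) : R :=
  \sum_(v <- undup (map fst d)) v * Num.min (Pmass d v) (Num.max (q - Pgt d v) 0).

Lemma mul_Ftop d q : is_fdist d -> q * Ftop d q = top_sum d q.
Proof.
move=> dd; have [->|q0] := eqVneq q 0; last by rewrite /Ftop mulrA mulfV // mul1r.
rewrite mul0r /top_sum big1 // => v _; rewrite sub0r.
by rewrite (max_idPr _) ?oppr_le0 ?Pgt_ge0 // (min_idPr _) ?mulr0 ?Pmass_ge0.
Qed.

Lemma Pge_le_Pgt d x y : is_fdist d -> x < y -> Pgt d y + Pmass d y <= Pgt d x.
Proof.
move=> dd xy; rewrite !PgtE PmassE -fexpD; apply: le_fexp => // e _.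
have [ye|ey|ye] := ltgtP y e.1; first by rewrite (lt_trans xy ye) addr0.
  by rewrite add0r ler0n.
by rewrite -ye xy add0r.
Qed.

(** Take for [t] the least atom with mass at most [q] strictly above it. The next smaller atom [w],
    if any, violates this, and the mass above [w] is exactly the mass at or above [t]; without such
    a [w] that mass is 1. *)
Lemma fdist_quantile d q : is_fdist d -> 0 <= q <= 1 ->
  exists2 t, t \in map fst d & Pgt d t <= q <= Pgt d t + Pmass d t.
Proof.
move=> dd /andP[q0 q1]; have [d0 d1] := dd.
have : has predT (map fst d).
  rewrite has_predT size_map; case: (d) d1 => //.
  by rewrite big_nil => /eqP; rewrite eq_sym oner_eq0.
move=> /seq_argmax [m /andP[md _] mmax].
have : has (fun x => Pgt d x <= q) (map fst d).
  apply/hasP; exists m => //=; rewrite PgtE fexp0 // => e ed.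
  by rewrite ltNge mmax ?map_f.
move=> /seq_argmin [t /andP[td tq] tmin].
exists t => //; rewrite tq /= leNgt; apply/negP => qt.
case: (boolP (has (fun x => x < t) (map fst d))) => [|/hasPn ge_t]; last first.
  suff : Pgt d t + Pmass d t = 1 by lra.
  rewrite PgtE PmassE -fexpD -[RHS](fexp_cst 1 dd); apply: eq_fexp => e ed.
  have := ge_t _ (map_f _ ed); rewrite -leNgt => te.
  by case: ltgtP te; rewrite /= ?addr0 ?add0r.
move=> /seq_argmax [w /andP[wd wt] wmax].
suff wq : Pgt d w <= q by have := tmin _ wd wq; rewrite leNgt wt.
suff -> : Pgt d w = Pgt d t + Pmass d t by exact: ltW.
rewrite !PgtE PmassE -fexpD; apply: eq_fexp => e ed.
have [te|et|te] := ltgtP t e.1; first by rewrite (lt_trans wt te) addr0.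
  by rewrite addr0 ltNge wmax ?map_f.
by rewrite -te wt add0r.
Qed.

(** With [t] a [q]-quantile, the top [q] mass consists of everything above [t] and of [q - Pgt d t]
    taken from the atom [t]. Thus [t] acts as the multiplier of the constraint that the mass taken
    be [q]. *)
Lemma excess_le_Ftop d q : is_fdist d -> 0 <= q <= 1 ->
  exists t, excess d t + t * q <= q * Ftop d q.
Proof.
move=> dd q01; have [t td /andP[tq qt]] := fdist_quantile dd q01.
exists t; rewrite mul_Ftop // /top_sum.
have -> : excess d t + t * q = fexp d (fun x => (x - t) * (t < x)%R%:R) + t * q.
  congr (_ + _); apply: eq_fexp => e _; rewrite ltNge.
  have [et|te] := leP e.1 t; first by rewrite mulr0 pos_eq0 ?subr_le0.
  by rewrite mulr1 pos_id // subr_ge0 ltW.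
have -> : fexp d (fun x => (x - t) * (t < x)%R%:R) =
    fexp d (fun x => x * (t < x)%R%:R) - t * Pgt d t.
  by rewrite PgtE -fexpM -fexpB; apply: eq_fexp => e _; rewrite mulrBl.
have dZ e : e \in d -> e.1 \in undup (map fst d).
  by move=> ed; rewrite mem_undup map_f.
rewrite -(sum_Pmass _ (undup_uniq _) dZ) -addrA.
(* The constant is placed on the atom [t], so that both sides can be compared atom by atom. *)
have -> : - (t * Pgt d t) + t * q =
    \sum_(v <- undup (map fst d)) (v == t)%:R * (t * (q - Pgt d t)).
  rewrite (bigD1_seq t) ?mem_undup ?undup_uniq //= eqxx mul1r big1 ?addr0; first by ring.
  by move=> v /negbTE ->; rewrite mul0r.
rewrite -big_split; apply: ler_sum => v _ /=.
have Pv := Pmass_ge0 v dd.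
have [tv|vt|<-] := ltgtP t v.
- rewrite mulr1 mul0r addr0 (min_idPl _) // le_max; apply/orP; left.
  by have := Pge_le_Pgt dd tv; lra.
- rewrite mulr0 !mul0r addr0 (max_idPr _) ?(min_idPr _) ?mulr0 //.
  by have := Pge_le_Pgt dd vt; lra.
- rewrite mulr0 !mul0r add0r mul1r (max_idPl _) ?subr_ge0 // (min_idPr _) //; lra.
Qed.

End FiniteDistributions.

(** * Surrogate values of a Markov chain *)

Section Surrogates.
Variables (R : realType) (S : finType).

(** Components of weight zero are dropped, so that only the laws [D s] with [0 < w s] influence the
    support and validity of the mixture. *)
Definition mixture (w : S -> R) (D : S -> fdist R) (f : R -> R) : fdist R :=
  [seq (f e.1, w s * e.2) | s <- [seq s <- enum S | 0 < w s], e <- D s].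

Lemma fexp_mixture w D f g : (forall s, 0 <= w s) ->
  fexp (mixture w D f) g = \sum_s w s * fexp (D s) (g \o f).
Proof.
move=> w0; rewrite /fexp /mixture big_allpairs_dep /= big_filter big_enum_cond /=.
rewrite [RHS](bigID (fun s => 0 < w s)) /= [X in _ = _ + X]big1 ?addr0; last first.
  by move=> s; rewrite lt_neqAle w0 andbT negbK => /eqP <-; rewrite mul0r.
apply: eq_bigr => s _; rewrite mulr_sumr; apply: eq_bigr => e _.
by rewrite mulrA.
Qed.

Lemma mem_mixture w D f e : e \in mixture w D f ->
  exists s e', [/\ 0 < w s, e' \in D s & e = (f e'.1, w s * e'.2)].
Proof.
case/allpairsPdep => s [e' [sw e'D ->]]; exists s, e'; split=> //.
by move: sw; rewrite mem_filter => /andP[].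
Qed.

Lemma is_fdist_mixture w D f : (forall s, 0 <= w s) -> \sum_s w s = 1 ->
  (forall s, 0 < w s -> is_fdist (D s)) -> is_fdist (mixture w D f).
Proof.
move=> w0 w1 Dd; split.
  move=> e /mem_mixture [s [e' [ws e'D ->]]] /=.
  by rewrite mulr_ge0 //; case: (Dd s ws) => + _; apply.
have := fexp_mixture D f (fun=> 1) w0; rewrite {1}/fexp.
under eq_bigr do rewrite mulr1.
move=> ->; rewrite -[RHS]w1; apply: eq_bigr => s _.
have [->|ws] := eqVneq (w s) 0; first by rewrite mul0r.
by rewrite /comp fexp_cst ?mulr1 //; apply: Dd; rewrite lt_neqAle eq_sym ws w0.
Qed.

Variables (term : pred S) (v : S -> R) (P : S -> S -> R) (C : S -> R).
Variable rk : S -> nat.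

(* [D s] is the law of the smallest index met from [s] on, [sigma s] the
   (Weitzman/Gittins) index of [s]: the cap at which paying [C s] to move on is
   exactly compensated by the expected excess over the cap. *)
Record surrogate_at (D : S -> fdist R) (sigma : S -> R) (s : S) : Prop :=
  SurrogateAt {
    surr_fdist : is_fdist (D s);
    surr_le : forall e, e \in D s -> e.1 <= sigma s;
    surr_range : forall e, e \in D s -> exists s', e.1 = sigma s';
    surr_term : term s -> D s = [:: (v s, 1)] /\ sigma s = v s;
    surr_cost : ~~ term s -> \sum_s' P s s' * excess (D s') (sigma s) = C s;
    surr_step : ~~ term s -> forall g, fexp (D s) g =
      \sum_s' P s s' * fexp (D s') (fun x => g (Num.min (sigma s) x)) }.

Hypothesis P_ge0 : forall s s', ~~ term s -> 0 <= P s s'.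
Hypothesis P_sum1 : forall s, ~~ term s -> \sum_s' P s s' = 1.
Hypothesis C_ge0 : forall s, ~~ term s -> 0 <= C s.
Hypothesis P_rk : forall s s', ~~ term s -> 0 < P s s' -> (rk s' < rk s)%N.

(** Induction on a bound for the rank. Successors of a state of rank [k] have smaller rank, so their
    laws are known; [excess_surj] applied to the mixture of these laws yields the index of the
    state, and capping the mixture there yields its law. *)
Lemma surrogate_exists : exists D sigma, forall s, surrogate_at D sigma s.
Proof.
(* The range is tracked within ranks below [k], because only there does the extension to the next
   rank leave [sigma] unchanged. *)
suff H k : exists D sigma, forall s, (rk s < k)%N ->
    surrogate_at D sigma s /\
    (forall e, e \in D s -> exists2 s', (rk s' < k)%N & e.1 = sigma s').
  have [D [sigma Ds]] := H (\max_s rk s).+1; exists D, sigma => s.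
  by apply: (Ds s _).1; rewrite ltnS leq_bigmax.
elim: k => [|k [D [sigma IH]]]; first by exists (fun=> [::]), (fun=> 0).
have /choice [z zP] : forall s, exists z, ~~ term s -> rk s = k ->
    \sum_s' P s s' * excess (D s') z = C s.
  move=> s; case: (boolP (term s)) => [|st]; first by exists 0.
  have [rs|rs] := eqVneq (rk s) k; last by exists 0 => _ /eqP; rewrite (negbTE rs).
  have Dd : is_fdist (mixture (P s) D id).
    apply: is_fdist_mixture => [s'||s' Ps']; [exact: P_ge0|exact: P_sum1|].
    by apply: (surr_fdist (IH s' _).1); rewrite -rs P_rk.
  have [z zs] := excess_surj Dd (C_ge0 st).
  exists z => _ _; rewrite -zs [RHS]fexp_mixture //.
  by move=> s'; exact: P_ge0.
pose D' s := if (rk s < k)%N then D s else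
  if term s then [:: (v s, 1)] else mixture (P s) D (Num.min (z s)).
pose sigma' s := if (rk s < k)%N then sigma s else if term s then v s else z s.
have sumE s (h : fdist R -> R) : ~~ term s -> (rk s < k.+1)%N ->
    \sum_s' P s s' * h (D' s') = \sum_s' P s s' * h (D s').
  move=> st sk; apply: eq_bigr => s' _.
  have [->|Ps] := eqVneq (P s s') 0; first by rewrite !mul0r.
  rewrite /D' (leq_trans (P_rk st _)) //.
  by rewrite lt_neqAle eq_sym Ps P_ge0.
exists D', sigma' => s; rewrite ltnS leq_eqVlt => /orP[/eqP sk|sk]; last first.
  have [sD Dr] := IH s sk.
  have sk1 : (rk s < k.+1)%N by exact: ltnW.
  have eD : D' s = D s by rewrite /D' sk.
  have eS : sigma' s = sigma s by rewrite /sigma' sk.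
  have rng e : e \in D' s -> exists2 s', (rk s' < k.+1)%N & e.1 = sigma' s'.
    rewrite eD => /Dr [s' s'k ->]; exists s'; first exact: ltnW.
    by rewrite /sigma' s'k.
  split => //; case: sD => d1 d2 _ d4 d5 d6; split; rewrite ?eD ?eS //.
  - by move=> e; rewrite -eD => /rng [s' _]; exists s'.
  - by move=> st; rewrite (sumE s (fun d => excess d _)) //; exact: d5.
  - by move=> st g; rewrite (sumE s (fun d => fexp d _)) //; exact: d6.
have sk1 : (rk s < k.+1)%N by rewrite sk.
have eD : D' s = if term s then [:: (v s, 1)] else mixture (P s) D (Num.min (z s)).
  by rewrite /D' sk ltnn.
have eS : sigma' s = if term s then v s else z s by rewrite /sigma' sk ltnn.
have fdD s' : ~~ term s -> 0 < P s s' -> is_fdist (D s').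
  by move=> st Ps'; apply: (surr_fdist (IH s' _).1); rewrite -sk P_rk.
have rng e : e \in D' s -> exists2 s', (rk s' < k.+1)%N & e.1 = sigma' s'.
  rewrite eD; case: ifPn => st.
    by rewrite inE => /eqP -> /=; exists s; rewrite // eS st.
  case/mem_mixture => s' [e' [Ps' e'D ->]] /=.
  have s'k : (rk s' < k)%N by rewrite -sk P_rk.
  have [s2 s2k ->] := (IH s' s'k).2 _ e'D.
  have [_|_] := leP (z s) (sigma s2); first by exists s; rewrite // eS (negbTE st).
  by exists s2; [exact: ltnW|rewrite /sigma' s2k].
split=> //; split.
- rewrite eD; case: ifPn => st.
    split; first by move=> e; rewrite inE => /eqP -> /=; exact: ler01.
    by rewrite big_seq1.
  by apply: is_fdist_mixture => [s'||s']; [exact: P_ge0|exact: P_sum1|exact: fdD].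
- move=> e; rewrite eD eS; case: ifPn => st; first by rewrite inE => /eqP ->.
  by case/mem_mixture => s' [e' [_ _ ->]] /=; rewrite ge_min lexx.
- by move=> e /rng [s' _]; exists s'.
- by move=> st; rewrite eD eS st.
- move=> st; rewrite (sumE s (fun d => excess d _)) // eS (negbTE st).
  exact: zP.
- move=> st g; rewrite (sumE s (fun d => fexp d _)) // eS eD (negbTE st).
  by rewrite fexp_mixture // => s'; exact: P_ge0.
Qed.

End Surrogates.

(** * Expectations along the runs of a policy *)

Local Notation snoc h i a s' := (rcons h (existT _ i (a, s'))).

Section Runs.
Variables (R : realType) (n : nat) (F : {set {set 'I_n}}) (M : 'I_n -> mdp R).
Implicit Types (h : seq (Defs.step M)) (S : {set 'I_n}) (T : policy M).

Lemma cur_snoc h i (a : act (M i)) s' : cur (snoc h i a s') = dfwith (cur h) s'.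
Proof. by rewrite /cur -cats1 foldl_cat. Qed.

Lemma cur_in h i (a : act (M i)) s' : cur (snoc h i a s') i = s'.
Proof. by rewrite cur_snoc dfwith_in. Qed.

Lemma cur_out h i (a : act (M i)) s' j : i != j -> cur (snoc h i a s') j = cur h j.
Proof. by move=> ij; rewrite cur_snoc dfwith_out. Qed.

Implicit Types (gh : seq (Defs.step M) -> {set 'I_n} -> R)
  (ga : seq (Defs.step M) -> forall i, act (M i) -> R).

(** Arbitrary payoffs [gh] on halting and [ga] on advancing replace value and cost. Utilities,
    potentials, occupation counts and halting probabilities then become instances of one linear
    monotone functional. *)
Fixpoint run T gh ga (k : nat) h : R :=
  \sum_(S : {set 'I_n}) haltp T h S * gh h S
  + if k is k'.+1 then
      \sum_(i < n) \sum_(a : act (M i)) advp T h i a *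
        (ga h i a + \sum_(s' : st (M i)) trans (cur h i) a s' *
           run T gh ga k' (snoc h i a s'))
    else 0.

Lemma run_utilE T k h : run_util T k h =
  run T (fun h S => \sum_(i in S) Defs.tval (cur h i)) (fun h i a => - cost (cur h i) a) k h.
Proof.
elim: k h => [//|k IH] h /=; congr (_ + _).
apply: eq_bigr => i _; apply: eq_bigr => a _; congr (_ * (_ + _)).
by apply: eq_bigr => s' _; rewrite IH.
Qed.

Lemma run_add T gh ga gh' ga' k h :
  run T (fun h S => gh h S + gh' h S) (fun h i a => ga h i a + ga' h i a) k h =
  run T gh ga k h + run T gh' ga' k h.
Proof.
have E h0 : \sum_(S : {set 'I_n}) haltp T h0 S * (gh h0 S + gh' h0 S) =
   \sum_(S : {set 'I_n}) haltp T h0 S * gh h0 S + \sum_(S : {set 'I_n}) haltp T h0 S * gh' h0 S.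
  by rewrite -big_split; apply: eq_bigr => S _; rewrite mulrDr.
elim: k h => [|k IH] h /=; first by rewrite E !addr0.
rewrite E addrACA; congr (_ + _); rewrite -big_split; apply: eq_bigr => i _ /=.
rewrite -big_split; apply: eq_bigr => a _ /=; rewrite -mulrDr addrACA -big_split.
by congr (_ * (_ + _)); apply: eq_bigr => s' _; rewrite IH mulrDr.
Qed.

Lemma run_scale T c gh ga k h :
  run T (fun h S => c * gh h S) (fun h i a => c * ga h i a) k h = c * run T gh ga k h.
Proof.
have E h0 : \sum_(S : {set 'I_n}) haltp T h0 S * (c * gh h0 S) =
   c * \sum_(S : {set 'I_n}) haltp T h0 S * gh h0 S.
  by rewrite mulr_sumr; apply: eq_bigr => S _; rewrite mulrCA.
elim: k h => [|k IH] h /=; first by rewrite E !addr0.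
rewrite E mulrDr; congr (_ + _); rewrite mulr_sumr; apply: eq_bigr => i _.
rewrite mulr_sumr; apply: eq_bigr => a _ /=; rewrite [RHS]mulrCA; congr (_ * _).
rewrite mulrDr; congr (_ + _); rewrite mulr_sumr.
by apply: eq_bigr => s' _; rewrite IH mulrCA.
Qed.

Lemma eq_run T gh ga gh' ga' k h :
  (forall h S, gh h S = gh' h S) -> (forall h i a, ga h i a = ga' h i a) ->
  run T gh ga k h = run T gh' ga' k h.
Proof.
move=> eh ea; have -> : gh = gh' by apply/funext => x; apply/funext.
suff -> : ga = ga' by [].
by apply/functional_extensionality_dep => x; apply/functional_extensionality_dep => i;
   apply/funext.
Qed.

Lemma run0 T k h : run T (fun _ _ => 0) (fun _ _ _ => 0) k h = 0.
Proof.
transitivity (run T (fun _ _ => 0 * 0) (fun _ _ _ => 0 * 0) k h).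
  by apply: eq_run => *; rewrite mul0r.
by rewrite (run_scale T 0 (fun _ _ => 0) (fun _ _ _ => 0)) mul0r.
Qed.

Lemma run_sum T (I : finType) (gh : I -> seq (Defs.step M) -> {set 'I_n} -> R)
    (ga : I -> seq (Defs.step M) -> forall i, act (M i) -> R) k h :
  run T (fun h S => \sum_(x : I) gh x h S) (fun h i a => \sum_(x : I) ga x h i a) k h =
  \sum_(x : I) run T (gh x) (ga x) k h.
Proof.
elim: (index_enum I) => [|x r IH].
  rewrite big_nil; apply: etrans (run0 T k h).
  by apply: eq_run => *; exact: big_nil.
rewrite big_cons -IH -run_add; apply: eq_run => *; exact: big_cons.
Qed.

Hypothesis wfM : wf_instance M.
Variable T : policy M.
Hypothesis vT : valid_policy F T.

Lemma trans_ge0 i (s : st (M i)) a s' : avail s a -> 0 <= trans s a s'.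
Proof. by move=> sa; have [_ [/(_ s a sa) [+ _] _]] := wfM i; apply. Qed.

Lemma trans_sum1 i (s : st (M i)) a : avail s a -> \sum_s' trans s a s' = 1.
Proof. by move=> sa; have [_ [/(_ s a sa) [_ +] _]] := wfM i. Qed.

Lemma advp_gt0 h i a : advp T h i a != 0 -> 0 < advp T h i a.
Proof. by have [_ [a0 _]] := vT; rewrite lt_neqAle eq_sym a0 andbT. Qed.

Lemma le_run gh ga gh' ga' k h :
  (forall h S, 0 < haltp T h S -> gh h S <= gh' h S) ->
  (forall h i a, 0 < advp T h i a -> ga h i a <= ga' h i a) ->
  run T gh ga k h <= run T gh' ga' k h.
Proof.
have [h0 [a0 [_ [_ av]]]] := vT.
move=> leh lea; have H h1 : \sum_(S : {set 'I_n}) haltp T h1 S * gh h1 S <=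
    \sum_(S : {set 'I_n}) haltp T h1 S * gh' h1 S.
  apply: ler_sum => S _; have [->|hS] := eqVneq (haltp T h1 S) 0; first by rewrite !mul0r.
  by rewrite ler_wpM2l // leh // lt_neqAle eq_sym hS h0.
elim: k h => [|k IH] h /=; first by rewrite lerD2r.
apply: lerD => //; apply: ler_sum => i _; apply: ler_sum => a _.
have [->|/advp_gt0 ha] := eqVneq (advp T h i a) 0; first by rewrite !mul0r.
rewrite ler_wpM2l // lerD ?lea // ler_sum // => s' _.
by rewrite ler_wpM2l // trans_ge0 // av.
Qed.

Lemma haltp_le1 h : \sum_(S : {set 'I_n}) haltp T h S <= 1.
Proof.
have [_ [a0 [sum1 _]]] := vT.
by rewrite -(sum1 h) lerDl; apply: sumr_ge0 => i _; apply: sumr_ge0.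
Qed.

(** Only an inequality, since runs cut off by the fuel [k] never collect the halting payoff. *)
Lemma run_halt_le1 k h : run T (fun _ _ => 1) (fun _ _ _ => 0) k h <= 1.
Proof.
have [_ [a0 [sum1 [_ av]]]] := vT.
elim: k h => [|k IH] h /=.
  by rewrite addr0 -mulr_suml mulr1 haltp_le1.
rewrite -[leRHS](sum1 h) -mulr_suml mulr1 lerD2l.
apply: ler_sum => i _; apply: ler_sum => a _.
have [->|/advp_gt0 ha] := eqVneq (advp T h i a) 0; first by rewrite !mul0r.
rewrite -[leRHS]mulr1 ler_wpM2l // add0r -[leRHS](trans_sum1 (av _ _ _ ha)).
apply: ler_sum => s' _; rewrite -[leRHS]mulr1 ler_wpM2l ?IH //.
by rewrite trans_ge0 // av.
Qed.

(** Telescoping: each advance pays the expected drop of the potential and halting pays what remains.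
    Runs cut off by the fuel forfeit a nonnegative remainder. *)
Lemma run_potential (V : forall i, st (M i) -> R) k h : (forall i s, 0 <= V i s) ->
  run T (fun h _ => \sum_(i < n) V i (cur h i))
    (fun h i a => V i (cur h i) - \sum_(s' : st (M i)) trans (cur h i) a s' * V i s') k h
  <= \sum_(i < n) V i (cur h i).
Proof.
move=> V0; set gh := (X in run T X); set ga := (X in run T _ X).
have [_ [a0 [sum1 [_ av]]]] := vT.
elim: k h => [|k IH] h /=.
  rewrite /gh addr0 -mulr_suml ler_piMl ?haltp_le1 //; exact: sumr_ge0.
rewrite {1}/gh {1}/ga /=; set W := \sum_(i < n) _; rewrite -mulr_suml.
rewrite -[leRHS]mul1r -(sum1 h) mulrDl lerD2l mulr_suml.
apply: ler_sum => i _; rewrite mulr_suml; apply: ler_sum => a _.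
have [->|/advp_gt0 ha] := eqVneq (advp T h i a) 0; first by rewrite !mul0r.
rewrite ler_wpM2l //; pose U s' := run T gh ga k (snoc h i a s').
have E : \sum_s' trans (cur h i) a s' * (V i s' + (W - V i (cur h i))) =
    \sum_s' trans (cur h i) a s' * V i s' + (W - V i (cur h i)).
  under eq_bigr do rewrite mulrDr.
  by rewrite big_split /= -mulr_suml trans_sum1 ?av // mul1r.
suff H : \sum_s' trans (cur h i) a s' * U s' <=
    \sum_s' trans (cur h i) a s' * (V i s' + (W - V i (cur h i))).
  by rewrite E /U in H; lra.
apply: ler_sum => s' _; rewrite ler_wpM2l ?trans_ge0 ?av // /U.
apply: le_trans (IH _) _.
have -> : W - V i (cur h i) = \sum_(j < n | j != i) V j (cur h j).
  by rewrite /W (bigD1 i) //= addrAC subrr add0r.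
rewrite (bigD1 i) //= cur_in lerD2l.
by apply: ler_sum => j ji; rewrite cur_out // eq_sym.
Qed.
End Runs.

(** * An optimal policy by backward induction *)

Section OptimalPolicy.
Variables (R : realType) (n : nat) (F : {set {set 'I_n}}) (M : 'I_n -> mdp R).
Hypothesis F0 : set0 \in F.
Hypothesis wfM : wf_instance M.
Implicit Types (h : seq (Defs.step M)) (S : {set 'I_n}) (T : policy M).

Let choiceT : Type := ({set 'I_n} + {i : 'I_n & act (M i)})%type.

Let adv i (a : act (M i)) : choiceT := inr (Tagged (fun i => act (M i)) a).

Definition allowed h (c : choiceT) : bool :=
  match c with
  | inl A => (A \in F) && [forall i in A, terminal (cur h i)]
  | inr x => avail (cur h (tag x)) (tagged x)
  end.

(** Bellman recursion: the value of playing [c] and then optimally with [k] advances in all. The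
    maximiser is inlined, as [best_choice] is defined from this function; its default [inl set0] is
    always allowed because [F] contains the empty set. *)
Fixpoint choice_value k h (c : choiceT) {struct k} : R :=
  match c with
  | inl A => \sum_(i in A) Defs.tval (cur h i)
  | inr x =>
    if k is k'.+1 then
      - cost (cur h (tag x)) (tagged x) +
      \sum_s' trans (cur h (tag x)) (tagged x) s' *
        (let h' := snoc h (tag x) (tagged x) s' in
         choice_value k' h'
           [arg max_(c > inl set0 | allowed h' c) choice_value k' h' c]%O)
    else 0
  end.

Definition best_choice k h : choiceT :=
  [arg max_(c > inl set0 | allowed h c) choice_value k h c]%O.

Lemma best_choiceP k h : allowed h (best_choice k h) /\
  forall c, allowed h c -> choice_value k h c <= choice_value k h (best_choice k h).
Proof.
have P0 : allowed h (inl set0).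
  by rewrite /= F0 /=; apply/forall_inP => i; rewrite inE.
by rewrite /best_choice; case: (arg_maxP _ P0) => c ac cmax; split.
Qed.

(** A policy does not see the fuel, so the number of advances left is recovered from the length of
    the history. *)
Definition greedy K : policy M :=
  Policy (fun h S => (best_choice (K - size h) h == inl S)%:R)
         (fun h i a => (best_choice (K - size h) h == adv a)%:R).

Lemma sum_choice (c : choiceT) (G : choiceT -> R) :
  \sum_(S : {set 'I_n}) (c == inl S)%:R * G (inl S) +
  \sum_(i < n) \sum_(a : act (M i)) (c == adv a)%:R * G (adv a) = G c.
Proof.
rewrite sig_big_dep /=.
have -> : \sum_(p : {i : 'I_n & act (M i)})
    (c == adv (tagged p))%:R * G (adv (tagged p)) =
    \sum_(p : {i : 'I_n & act (M i)}) (c == inr p)%:R * G (inr p).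
  by apply: eq_bigr => -[].
rewrite -(big_sumType _ xpredT (fun c' => (c == c')%:R * G c')) /=.
rewrite (bigD1 c) //= eqxx mul1r big1 ?addr0 // => c' cc'.
by rewrite eq_sym (negbTE cc') mul0r.
Qed.

Lemma greedy_valid K : valid_policy F (greedy K).
Proof.
have P1 h (c : choiceT) : 0 < (best_choice (K - size h) h == c)%:R :> R -> allowed h c.
  by case: eqP => [<- _|]; [exact: (best_choiceP _ h).1|rewrite ltxx].
split; first by move=> h A; exact: ler0n.
split; first by move=> h i a; exact: ler0n.
split.
  move=> h; rewrite -[RHS](sum_choice (best_choice (K - size h) h) (fun=> 1)).
  by congr (_ + _); apply: eq_bigr => *; [|apply: eq_bigr => *]; rewrite mulr1.
split.
  by move=> h A /P1 /andP[AF /forall_inP].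
by move=> h i a /P1.
Qed.

Lemma choice_valueS k h i (a : act (M i)) :
  choice_value k.+1 h (adv a) = - cost (cur h i) a +
    \sum_s' trans (cur h i) a s' *
      choice_value k (snoc h i a s') (best_choice k (snoc h i a s')).
Proof. by []. Qed.

Lemma greedy_run K k h : (k + size h = K)%N ->
  run_util (greedy K) k h = choice_value k h (best_choice k h).
Proof.
elim: k h => [|k IH] h kh.
  rewrite /= -kh add0n subnn addr0.
  rewrite -[RHS](sum_choice _ (choice_value 0 h)) /= [X in _ = _ + X]big1 ?addr0 //.
  by move=> i _; rewrite big1 // => a _; rewrite mulr0.
rewrite -[RHS](sum_choice _ (choice_value k.+1 h)).
have sz : (K - size h)%N = k.+1 by rewrite -kh addnK.
rewrite [LHS]/= sz; congr (_ + _); apply: eq_bigr => i _; apply: eq_bigr => a _.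
rewrite choice_valueS; congr (_ * (_ + _)); apply: eq_bigr => s' _.
by rewrite IH // size_rcons addnS -kh.
Qed.

(** A randomised policy averages over allowed choices, and an average is at most the maximum;
    [sum1'] writes the maximum as an average under the same weights. *)
Lemma run_util_le_best T k h : valid_policy F T ->
  run_util T k h <= choice_value k h (best_choice k h).
Proof.
move=> vT; have [h0 [a0 [sum1 [hF av]]]] := vT.
have Hh k' h' A : haltp T h' A * \sum_(i in A) Defs.tval (cur h' i) <=
    haltp T h' A * choice_value k' h' (best_choice k' h').
  have [->|hA] := eqVneq (haltp T h' A) 0; first by rewrite !mul0r.
  rewrite ler_wpM2l //.
  have /hF [AF tA] : 0 < haltp T h' A by rewrite lt_neqAle eq_sym hA h0.
  have := (best_choiceP k' h').2 (inl A); rewrite /= AF; case: k' => [|k'] /= -> //;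
  exact/forall_inP.
have sum1' h' c : c = \sum_(S : {set 'I_n}) haltp T h' S * c +
    \sum_(i < n) \sum_(a : act (M i)) advp T h' i a * c.
  rewrite -[LHS]mul1r -(sum1 h') mulrDl !mulr_suml; congr (_ + _).
  by apply: eq_bigr => i _; rewrite mulr_suml.
elim: k h => [|k IH] h.
  rewrite [leRHS](sum1' h) [leLHS]/=; apply: lerD; first by apply: ler_sum => A _; exact: Hh.
  apply: sumr_ge0 => i _; apply: sumr_ge0 => a _; rewrite mulr_ge0 //.
  (* Without fuel, advancing earns nothing, and selecting the empty set shows that the best value is
     nonnegative. *)
  have /(_ (inl set0)) := (best_choiceP 0 h).2.
  rewrite /= F0 big_set0; apply; apply/forall_inP => j; by rewrite inE.
rewrite [leRHS](sum1' h) [leLHS]/=; apply: lerD; first by apply: ler_sum => A _; exact: Hh.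
apply: ler_sum => i _; apply: ler_sum => a _.
have [->|ha] := eqVneq (advp T h i a) 0; first by rewrite !mul0r.
have /av aa : 0 < advp T h i a by rewrite lt_neqAle eq_sym ha a0.
rewrite ler_wpM2l //.
apply: le_trans ((best_choiceP k.+1 h).2 (adv a) aa).
rewrite choice_valueS lerD2l; apply: ler_sum => s' _.
by rewrite ler_wpM2l ?IH // (trans_ge0 wfM).
Qed.

Lemma Util_ubound T : valid_policy F T ->
  Util T <= Util (greedy (\sum_(i < n) #|{: st (M i)}|)).
Proof.
by move=> vT; rewrite [leRHS]greedy_run ?addn0 //; exact: run_util_le_best.
Qed.

Lemma Util_le_OPT T : valid_policy F T -> Util T <= OPT F M.
Proof.
move=> vT; apply: ub_le_sup; last by exists T.
by exists (Util (greedy (\sum_(i < n) #|{: st (M i)}|))) => _ [T' [vT' ->]]; exact: Util_ubound.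
Qed.

Lemma OPT_attained : exists2 T : policy M, valid_policy F T & OPT F M = Util T.
Proof.
set G := greedy (\sum_(i < n) #|{: st (M i)}|).
have vG : valid_policy F G := greedy_valid _.
exists G => //; apply/eqP; rewrite eq_le Util_le_OPT // andbT.
apply: ge_sup; first by exists (Util G), G.
by move=> _ [T [vT ->]]; exact: Util_ubound.
Qed.

End OptimalPolicy.

(** * The ex-ante bound *)

Section CommittedChains.
Variables (R : realType) (n : nat) (M : 'I_n -> mdp R).
Hypothesis wfM : wf_instance M.
Variable pi : forall i, st (M i) -> act (M i) -> R.
Hypothesis piP : commitment pi.

Definition chain_trans i (s s' : st (M i)) : R := \sum_a pi s a * trans s a s'.
Definition chain_cost i (s : st (M i)) : R := \sum_a pi s a * cost s a.
Definition rank i (s : st (M i)) : nat := #|connect (@tedge _ (M i)) s|.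

(** States reachable from [s'] are reachable from [s], while by acyclicity [s] itself is not
    reachable from [s']. *)
Lemma rank_lt i (s s' : st (M i)) : tedge s s' -> (rank s' < rank s)%N.
Proof.
move=> ss'; apply: proper_card; apply/properP; split.
  apply/subsetP => t; rewrite !inE; exact: connect_trans (connect1 ss').
exists s; first by rewrite inE connect0.
by have [_ [_ [/(_ s s' ss') + _]]] := wfM i; rewrite inE.
Qed.

Lemma chain_trans_ge0 i (s s' : st (M i)) : ~~ terminal s -> 0 <= chain_trans s s'.
Proof.
move=> /piP [p0 [pa _]]; apply: sumr_ge0 => a _.
have [->|pn] := eqVneq (pi s a) 0; first by rewrite mul0r.
by rewrite mulr_ge0 // (trans_ge0 wfM) // pa // lt_neqAle eq_sym pn p0.
Qed.

Lemma chain_trans_sum1 i (s : st (M i)) : ~~ terminal s -> \sum_s' chain_trans s s' = 1.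
Proof.
move=> /piP [p0 [pa p1]]; rewrite /chain_trans exchange_big -[RHS]p1 /=.
apply: eq_bigr => a _; rewrite -mulr_sumr.
have [->|pn] := eqVneq (pi s a) 0; first by rewrite mul0r.
by rewrite (trans_sum1 wfM) ?mulr1 // pa // lt_neqAle eq_sym pn p0.
Qed.

Lemma chain_cost_ge0 i (s : st (M i)) : ~~ terminal s -> 0 <= chain_cost s.
Proof.
move=> /piP [p0 [pa _]]; apply: sumr_ge0 => a _.
have [->|pn] := eqVneq (pi s a) 0; first by rewrite mul0r.
have [c0 _] := wfM i.
by rewrite mulr_ge0 // c0 // pa // lt_neqAle eq_sym pn p0.
Qed.

Lemma chain_rank i (s s' : st (M i)) :
  ~~ terminal s -> 0 < chain_trans s s' -> (rank s' < rank s)%N.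
Proof.
move=> st /lt0r_neq0 /eqP P0; apply: rank_lt; rewrite /tedge.
apply: contraT => /existsPn ss'.
have [p0 [pa _]] := piP st.
case: P0; apply: big1 => a _.
have [->|pn] := eqVneq (pi s a) 0; first by rewrite mul0r.
have sa : avail s a by rewrite pa // lt_neqAle eq_sym pn p0.
have := ss' a; rewrite sa /= -leNgt => tle.
suff -> : trans s a s' = 0 by rewrite mulr0.
by apply: le_anti; rewrite tle (trans_ge0 wfM).
Qed.

Definition surrogates (D : forall i, st (M i) -> fdist R) (sigma : forall i, st (M i) -> R) :=
  forall i s, surrogate_at (@terminal _ (M i)) (@Defs.tval _ (M i))
    (@chain_trans i) (@chain_cost i) (D i) (sigma i) s.

Lemma surrogates_exist : exists D sigma, surrogates D sigma.
Proof.
have H i : exists Dsig : (st (M i) -> fdist R) * (st (M i) -> R), forall s,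
    surrogate_at (@terminal _ (M i)) (@Defs.tval _ (M i))
      (@chain_trans i) (@chain_cost i) Dsig.1 Dsig.2 s.
  have [D [sigma Ds]] := @surrogate_exists R (st (M i)) (@terminal _ (M i))
    (@Defs.tval _ (M i)) _ _ _ (@chain_trans_ge0 i) (@chain_trans_sum1 i)
    (@chain_cost_ge0 i) (@chain_rank i).
  by exists (D, sigma).
exists (fun i => (projT1 (cid (H i))).1), (fun i => (projT1 (cid (H i))).2) => i.
exact: projT2 (cid (H i)).
Qed.

Variables (D : forall i, st (M i) -> fdist R) (sigma : forall i, st (M i) -> R).
Hypothesis DP : surrogates D sigma.

(* The expected excess over a price [t] is a supermartingale for the chain with
   optional stopping, so it bounds what any stopping rule can earn. *)
Lemma excess_superharmonic t i (s : st (M i)) : ~~ terminal s ->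
  \sum_s' chain_trans s s' * excess (D s') t - chain_cost s <= excess (D s) t.
Proof.
move=> st; rewrite /excess (surr_step (DP s) st) -(surr_cost (DP s) st) -sumrB.
apply: ler_sum => s' _; rewrite -mulrBr -fexpB ler_wpM2l ?chain_trans_ge0 //.
apply: le_fexp; first exact: surr_fdist (DP s').
by move=> e _; exact: pos_min_ge.
Qed.

Lemma excess_terminal t i (s : st (M i)) : terminal s ->
  excess (D s) t = pos (Defs.tval s - t).
Proof.
by move=> st; have [-> _] := surr_term (DP s) st; rewrite /excess /fexp big_seq1 mul1r.
Qed.

End CommittedChains.

(** Ensures that the supremum in [ExAnte] is a genuine upper bound: the mass taken at an atom never
    exceeds the mass of the atom. *)
Lemma ExAnte_bounded (R : realType) n (F : {set {set 'I_n}}) (D : 'I_n -> fdist R) :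
  (forall i, is_fdist (D i)) ->
  classical_sets.has_ubound (fun u => exists q : 'I_n -> R,
    in_hull F q /\ u = \sum_(i < n) q i * Ftop (D i) (q i)).
Proof.
move=> Dd; exists (\sum_(i < n) \sum_(v <- undup (map fst (D i))) `|v| * Pmass (D i) v).
move=> _ [q [_ ->]]; apply: ler_sum => i _; rewrite mul_Ftop //.
apply: ler_sum => v _; have Pv := Pmass_ge0 v (Dd i).
apply: le_trans (ler_norm _) _; rewrite normrM ler_wpM2l // ger0_norm ?ge_min ?lexx //.
by rewrite le_min Pv le_max lexx orbT.
Qed.

(** * Occupation measure of a policy and the commitment it induces *)

Section Occupancy.
Variables (R : realType) (n : nat) (F : {set {set 'I_n}}) (M : 'I_n -> mdp R).
Hypothesis F0 : set0 \in F.
Hypothesis wfM : wf_instance M.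
Variable T : policy M.
Hypothesis vT : valid_policy F T.
Variable K : nat.

(** Actions of different processes have different types, hence the comparison as tagged pairs. *)
Let same_act i j (a : act (M i)) (b : act (M j)) : bool :=
  Tagged (fun i => act (M i)) a == Tagged (fun i => act (M i)) b.

(** The occupation measure: the expected number of times that [T] plays [a] at [s] within the
    fuel. *)
Definition occupancy i (s : st (M i)) (a : act (M i)) : R :=
  run T (fun _ _ => 0) (fun h j b => (same_act b a && (cur h i == s))%:R) K [::].

(** A step payoff that sees only the current state and action is a combination of indicators, and
    [run] is linear. *)
Lemma run_occupancy (f : forall i, st (M i) -> act (M i) -> R) :
  run T (fun _ _ => 0) (fun h i a => f i (cur h i) a) K [::] =
  \sum_(i < n) \sum_(s : st (M i)) \sum_(a : act (M i)) occupancy s a * f i s a.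
Proof.
transitivity (run T (fun _ _ => \sum_(i < n) \sum_(s : st (M i)) \sum_(a : act (M i)) 0)
  (fun h j b => \sum_(i < n) \sum_(s : st (M i)) \sum_(a : act (M i))
     f i s a * (same_act b a && (cur h i == s))%:R) K [::]).
  apply: eq_run => h j.
    by rewrite big1 // => i _; rewrite big1 // => s _; rewrite big1.
  move=> b; rewrite (bigD1 j) //= [X in _ = _ + X]big1 ?addr0; last first.
    move=> i ij; rewrite big1 // => s _; rewrite big1 // => a _.
    rewrite /same_act -tag_eqE /tag_eq /= eq_sym (negbTE ij) /=.
    by rewrite mulr0.
  rewrite (bigD1 (cur h j)) //= [X in _ = _ + X]big1 ?addr0; last first.
    move=> s sc; rewrite big1 // => a _.
    by rewrite [cur h j == s]eq_sym (negbTE sc) andbF mulr0.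
  rewrite (bigD1 b) //= big1 ?addr0; first by rewrite /same_act !eqxx mulr1.
  by move=> a ab; rewrite /same_act eq_Tagged /= eq_sym (negbTE ab) mulr0.
rewrite run_sum; apply: eq_bigr => i _; rewrite run_sum; apply: eq_bigr => s _.
rewrite run_sum; apply: eq_bigr => a _; rewrite mulrC -run_scale.
by apply: eq_run => // *; rewrite mulr0.
Qed.

Lemma occupancy_ge0 i (s : st (M i)) a : 0 <= occupancy s a.
Proof.
rewrite -(run0 T K [::]); apply: (le_run wfM vT) => // h j b _; exact: ler0n.
Qed.

Lemma occupancy_avail i (s : st (M i)) a : 0 < occupancy s a -> avail s a.
Proof.
apply: contraTT => sa; rewrite -leNgt -(run0 T K [::]).
apply: (le_run wfM vT) => // h j b hb.
case: (boolP (same_act b a)) => //= /eqP ba; case: eqP => // cs.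
have avE (x y : {i : 'I_n & act (M i)}) : x = y ->
    avail (cur h (tag x)) (tagged x) -> avail (cur h (tag y)) (tagged y) by move=> ->.
have [_ [_ [_ [_ /(_ h j b hb) bj]]]] := vT.
by have := avE _ _ ba bj; rewrite /= cs (negbTE sa).
Qed.

(** Fallback for states at which [T] never acts, where conditional frequencies are undefined. *)
Definition default_action i (s : st (M i)) (a : act (M i)) : R :=
  if [pick b | avail s b] is Some b then (a == b)%:R else 0.

Lemma default_actionP : commitment default_action.
Proof.
move=> i s; rewrite negb_forall => /existsP[b0]; rewrite negbK => b0s.
rewrite /default_action; case: pickP => [b bs|/(_ b0)]; last by rewrite b0s.
split; first by move=> a; exact: ler0n.
split; first by move=> a; case: eqP => [->|]; rewrite ?ltxx.
by rewrite (bigD1 b) //= eqxx big1 ?addr0 // => a /negbTE ->.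
Qed.

Definition induced_commitment i (s : st (M i)) (a : act (M i)) : R :=
  let z := \sum_b occupancy s b in
  if z == 0 then default_action s a else occupancy s a / z.

Lemma induced_commitmentP : commitment induced_commitment.
Proof.
move=> i s st; rewrite /induced_commitment /=.
case: (eqVneq (\sum_b occupancy s b) 0) => [_|z0]; first exact: default_actionP.
have zge0 : 0 <= \sum_b occupancy s b by apply: sumr_ge0 => b _; exact: occupancy_ge0.
have zgt0 : 0 < \sum_b occupancy s b by rewrite lt_neqAle eq_sym z0.
split; first by move=> a; rewrite divr_ge0 // occupancy_ge0.
split; first by move=> a; rewrite pmulr_lgt0 ?invr_gt0 //; exact: occupancy_avail.
by rewrite -mulr_suml divff.
Qed.

Lemma occupancyE i (s : st (M i)) a :
  occupancy s a = (\sum_b occupancy s b) * induced_commitment s a.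
Proof.
rewrite /induced_commitment /=; case: eqP => [z0|/eqP z0]; last by rewrite mulrC divfK.
rewrite z0 mul0r; apply/eqP; move/eqP: z0; rewrite psumr_eq0; last first.
  by move=> b _; exact: occupancy_ge0.
by move=> /allP /(_ a); rewrite mem_index_enum; apply.
Qed.

Definition halting (S : {set 'I_n}) : R :=
  run T (fun _ S' => (S' == S)%:R) (fun _ _ _ => 0) K [::].

Definition selection (i : 'I_n) : R := \sum_(S : {set 'I_n} | i \in S) halting S.

Lemma halting_ge0 S : 0 <= halting S.
Proof. by rewrite -(run0 T K [::]); apply: (le_run wfM vT) => // *; exact: ler0n. Qed.

Lemma run_halting (f : {set 'I_n} -> R) :
  run T (fun _ S => f S) (fun _ _ _ => 0) K [::] = \sum_S halting S * f S.
Proof.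
transitivity (run T (fun _ S => \sum_S' f S' * (S == S')%:R)
    (fun _ _ _ => \sum_(S' : {set 'I_n}) 0) K [::]).
  apply: eq_run => h S; last by move=> a; rewrite big1.
  rewrite (bigD1 S) //= eqxx mulr1 big1 ?addr0 // => S' /negbTE.
  by rewrite eq_sym => ->; rewrite mulr0.
rewrite run_sum; apply: eq_bigr => S _; rewrite mulrC -run_scale.
by apply: eq_run => // *; rewrite mulr0.
Qed.

Lemma sum_halting_le1 : \sum_S halting S <= 1.
Proof.
apply: le_trans (run_halt_le1 wfM vT K [::]).
rewrite run_halting; apply: ler_sum => S _; by rewrite mulr1.
Qed.

(* Runs cut off by the fuel are counted as selecting the empty set. *)
Lemma selection_in_hull : in_hull F selection.
Proof.
exists (fun S => halting S + (S == set0)%:R * (1 - \sum_S' halting S')).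
split.
  move=> S; rewrite addr_ge0 ?halting_ge0 // mulr_ge0 ?ler0n // subr_ge0.
  exact: sum_halting_le1.
split.
  move=> S SF; case: eqVneq => [S0|_]; first by rewrite S0 F0 in SF.
  rewrite mul0r addr0; apply/eqP; rewrite eq_le halting_ge0 andbT.
  rewrite -(run0 T K [::]); apply: (le_run wfM vT) => // h S' hS.
  have [_ [_ [_ [/(_ h S' hS) [S'F _] _]]]] := vT.
  by case: eqP => // SS'; rewrite -SS' S'F in SF.
split.
  have E : \sum_(S : {set 'I_n}) (S == set0)%:R = 1 :> R.
    by rewrite (bigD1 set0) //= eqxx big1 ?addr0 // => S /negbTE ->.
  by rewrite big_split /= -mulr_suml E mul1r addrC subrK.
move=> i; apply: eq_bigr => S iS; case: eqP => [S0|]; last by rewrite mul0r addr0.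
by rewrite S0 inE in iS.
Qed.

Lemma selection01 i : 0 <= selection i <= 1.
Proof.
rewrite sumr_ge0 /=; last by move=> S _; exact: halting_ge0.
apply: le_trans sum_halting_le1; rewrite [leRHS](bigID (fun S : {set 'I_n} => i \in S)) /= lerDl.
by apply: sumr_ge0 => S _; exact: halting_ge0.
Qed.

Lemma sum_selection (t : 'I_n -> R) :
  \sum_S halting S * \sum_(i in S) t i = \sum_i selection i * t i.
Proof.
under eq_bigr do rewrite big_mkcond mulr_sumr.
rewrite exchange_big; apply: eq_bigr => i _ /=; rewrite /selection mulr_suml [RHS]big_mkcond.
by apply: eq_bigr => S _; case: ifP; rewrite ?mulr0.
Qed.

Variables (D : forall i, st (M i) -> fdist R) (sigma : forall i, st (M i) -> R).
Hypothesis DP : surrogates induced_commitment D sigma.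

(** Lagrangian bound: charge [t i] for selecting [i] and use the excess [V] over this price as
    potential. The cost of an advance is the expected gain of [V] plus a defect [phi], whose total
    expectation is nonnegative. *)
Lemma run_util_le_priced (t : 'I_n -> R) :
  run_util T K [::] <=
  \sum_i (excess (D (Defs.root (M i))) (t i) + t i * selection i).
Proof.
pose V i (s : st (M i)) := excess (D s) (t i).
have V0 i s : 0 <= V i s by apply: excess_ge0; exact: surr_fdist (DP s).
pose phi i (s : st (M i)) a := V i s - \sum_s' trans s a s' * V i s' + cost s a.
(* No sign is claimed for the defect of a single action. At each state [T] uses the actions in the
   proportions of [induced_commitment], and the average defect is the gap in
   [excess_superharmonic]. *)
have phi0 : 0 <= run T (fun _ _ => 0) (fun h i a => phi i (cur h i) a) K [::].
  rewrite run_occupancy; apply: sumr_ge0 => i _; apply: sumr_ge0 => s _.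
  under eq_bigr do rewrite occupancyE -mulrA.
  rewrite -mulr_sumr.
  have [st|st] := boolP (terminal s).
    rewrite big1 ?mul0r // => a _; apply/eqP; rewrite eq_le occupancy_ge0 andbT leNgt.
    by apply/negP => /occupancy_avail sa; move/forallP: st => /(_ a); rewrite sa.
  rewrite mulr_ge0 //; first by apply: sumr_ge0 => a _; exact: occupancy_ge0.
  have [_ [_ p1]] := induced_commitmentP st.
  have -> : \sum_a induced_commitment s a * phi i s a =
     V i s - (\sum_s' chain_trans induced_commitment s s' * V i s' -
       chain_cost induced_commitment s).
    have -> : \sum_s' chain_trans induced_commitment s s' * V i s' =
        \sum_a \sum_s' induced_commitment s a * trans s a s' * V i s'.
      by rewrite exchange_big; apply: eq_bigr => s' _; rewrite mulr_suml.
    have -> : V i s = \sum_a induced_commitment s a * V i s by rewrite -mulr_suml p1 mul1r.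
    rewrite /chain_cost -!sumrB; apply: eq_bigr => a _; rewrite /phi.
    under [in RHS]eq_bigr do rewrite -mulrA.
    by rewrite -mulr_sumr; ring.
  rewrite subr_ge0; exact: (excess_superharmonic wfM induced_commitmentP DP).
have pot := run_potential wfM vT K [::] V0.
(* For advances both sides agree by the definition of [phi]. On halting, a selected value is at most
   its excess over [t i] plus [t i]. *)
have : run_util T K [::] <= run T (fun h S => \sum_i V i (cur h i))
    (fun h i a => V i (cur h i) - \sum_(s' : st (M i)) trans (cur h i) a s' * V i s') K [::]
    - run T (fun _ _ => 0) (fun h i a => phi i (cur h i) a) K [::]
    + run T (fun _ S => \sum_(i in S) t i) (fun _ _ _ => 0) K [::].
  rewrite -mulN1r -run_scale -!run_add run_utilE.
  apply: (le_run wfM vT) => [h S hS|h i a ha]; last by rewrite /phi; lra.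
  rewrite mulr0 addr0 (big_mkcond (mem S)) [X in _ <= _ + X](big_mkcond (mem S)) -big_split.
  apply: ler_sum => i _ /=; case: ifP => iS; last by rewrite addr0 V0.
  have [_ [_ [_ [/(_ h S hS) [_ /(_ i iS) ti] _]]]] := vT.
  by rewrite /V (excess_terminal DP) // -lerBlDr pos_ge.
move: pot phi0; rewrite run_halting sum_selection big_split /=.
have -> : \sum_(i < n) t i * selection i = \sum_(i < n) selection i * t i.
  by apply: eq_bigr => i _; rewrite mulrC.
rewrite /V /cur /=; lra.
Qed.

Lemma run_util_le_ExAnte :
  run_util T K [::] <= ExAnte F (fun i => D (Defs.root (M i))).
Proof.
have Dd i : is_fdist (D (Defs.root (M i))) := surr_fdist (DP _).
have /choice [t tP] i := excess_le_Ftop (Dd i) (selection01 i).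
apply: le_trans (run_util_le_priced t) _.
apply: le_trans (ler_sum _ (fun i _ => tP i)) _.
apply: ub_le_sup; first exact: ExAnte_bounded.
by exists selection; split; first exact: selection_in_hull.
Qed.

End Occupancy.

(** * Expectations over product distributions *)

(** Distributivity with a factor type depending on the index; [fprod] reduces it to sums over one
    tagged type. *)
Lemma sum_dffun_prod (R : comPzSemiRingType) (I : finType) (T : I -> finType)
    (G : forall i, T i -> R) :
  \sum_(j : {dffun forall i, T i}) \prod_i G i (j i) = \prod_i \sum_(k : T i) G i k.
Proof.
rewrite (reindex (@dffun_of_fprod I T)) /=; last exact/onW_bij/dffun_of_fprod_bij.
pose P_ i : {ffun T i -> R} := [ffun k => G i k].
transitivity (\sum_(t : fprod T) \prod_(i in I) P_ i (t i)).
  by apply: eq_bigr => t _; apply: eq_bigr => i _; rewrite !ffunE.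
rewrite big_fprod.
under [RHS]eq_bigr => i _.
  rewrite (eq_bigr (P_ i)); last by move=> k _; rewrite ffunE.
  rewrite (big_tag (fun i => P_ i) i).
  over.
by rewrite bigA_distr_big_dep.
Qed.

Section GridExpectation.
Variables (R : realType) (n : nat) (Z : seq R).
Hypothesis uZ : uniq Z.
Implicit Types (mu : 'I_n -> R -> R) (f : ('I_n -> R) -> R).

(** Expectation under a product of mass functions carried by one common grid [Z]. The index type
    does not depend on the laws, so expectations under different laws can be compared termwise. *)
Definition grid_exp mu f : R :=
  \sum_(y : {ffun 'I_n -> 'I_(size Z)})
    (\prod_i mu i (Z`_(y i))) * f (fun i => Z`_(y i)).

Lemma sum_grid (g : R -> R) : \sum_(k < size Z) g Z`_k = \sum_(z <- Z) g z.
Proof. by rewrite (big_nth 0) big_mkord. Qed.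

Lemma eq_grid_exp mu mu' f : (forall i z, mu i z = mu' i z) ->
  grid_exp mu f = grid_exp mu' f.
Proof.
by move=> E; apply: eq_bigr => y _; congr (_ * _); apply: eq_bigr => i _; rewrite E.
Qed.

(** The product weight is linear in its [i]-th factor. *)
Lemma grid_exp_mix (S : finType) (w : S -> R) (i : 'I_n) mu (mu' : S -> 'I_n -> R -> R) f :
  (forall s j z, j != i -> mu' s j z = mu j z) ->
  (forall z, mu i z = \sum_s w s * mu' s i z) ->
  grid_exp mu f = \sum_s w s * grid_exp (mu' s) f.
Proof.
move=> Ej Ei; under [RHS]eq_bigr do rewrite mulr_sumr.
rewrite exchange_big; apply: eq_bigr => y _ /=.
rewrite (bigD1 i) //= Ei !mulr_suml; apply: eq_bigr => s _.
rewrite [in RHS](bigD1 i) //= !mulrA; congr (_ * _ * _).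
by apply: eq_bigr => j ji; rewrite Ej.
Qed.

Lemma grid_exp_cst mu f c : (forall i, \sum_(z <- Z) mu i z = 1) ->
  (forall x, (forall i, mu i (x i) != 0) -> f x = c) -> grid_exp mu f = c.
Proof.
move=> mu1 fc; transitivity (\sum_(y : {ffun 'I_n -> 'I_(size Z)})
    (\prod_i mu i (Z`_(y i))) * c).
  apply: eq_bigr => y _; have [/eqP ->|p0] := boolP (\prod_i mu i Z`_(y i) == 0).
    by rewrite !mul0r.
  by rewrite fc // => i; move/prodf_neq0: p0; apply.
rewrite -mulr_suml -(bigA_distr_bigA (fun i (k : 'I_(size Z)) => mu i Z`_k)) /=.
rewrite big1 ?mul1r // => i _.
by rewrite (sum_grid (mu i)).
Qed.

(** Every tuple of atoms is sent to the grid point of its values; list entries with equal value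
    merge into [Pmass]. *)
Lemma Val_grid (F : {set {set 'I_n}}) (D : 'I_n -> fdist R) (A : salg R n) :
  (forall i e, e \in D i -> e.1 \in Z) ->
  Val F D A = grid_exp (fun i => Pmass (D i)) (fun x => \sum_(i in final_set F x A) x i).
Proof.
move=> DZ; set f := fun x => \sum_(i in final_set F x A) x i.
pose p i (k : 'I_(size (D i))) := (nth (0, 0) (D i) k).2.
pose v i (k : 'I_(size (D i))) := (nth (0, 0) (D i) k).1.
transitivity (\sum_(j : {dffun forall i : 'I_n, 'I_(size (D i))})
  \sum_(y : {ffun 'I_n -> 'I_(size Z)})
   (\prod_i (p i (j i) * (v i (j i) == Z`_(y i))%:R)) * f (fun i => Z`_(y i))).
  apply: eq_bigr => j _.
  have vZ i : v i (j i) \in Z by apply/(DZ i)/mem_nth.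
  have ltZ i : (index (v i (j i)) Z < size Z)%N by rewrite index_mem.
  pose y0 : {ffun 'I_n -> 'I_(size Z)} := [ffun i => Ordinal (ltZ i)].
  have y0E i : Z`_(y0 i) = v i (j i) by rewrite ffunE nth_index.
  rewrite (bigD1 y0) //= [X in _ = _ + X]big1 ?addr0; last first.
    move=> y yy0; have /existsP[i yi] : [exists i, y i != y0 i].
      apply: contraR yy0 => /existsPn yy0; apply/eqP/ffunP => i.
      by apply/eqP; have := yy0 i; rewrite negbK.
    rewrite (bigD1 i) //= -y0E nth_uniq // eq_sym.
    by rewrite (inj_eq val_inj) (negbTE yi) mulr0 !mul0r.
  congr (_ * _); first by apply: eq_bigr => i _; rewrite y0E eqxx mulr1.
  by rewrite -/(f _); congr f; apply/funext => i; rewrite y0E.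
rewrite exchange_big; apply: eq_bigr => y _ /=; rewrite -mulr_suml; congr (_ * _).
rewrite (sum_dffun_prod (fun i (k : 'I_(size (D i))) => p i k * (v i k == Z`_(y i))%:R)).
apply: eq_bigr => i _; rewrite PmassE /fexp (big_nth (0, 0)) big_mkord.
by apply: eq_bigr.
Qed.

End GridExpectation.

(** * Simulating a semi-online algorithm *)

Section SemiOnlineRuns.
Variables (R : realType) (n : nat) (F : {set {set 'I_n}}) (A : salg R n).
Hypothesis F0 : set0 \in F.
Implicit Types (x u : 'I_n -> R) (N : nat).

Definition trace x N := iter N (sstep F x A) [::].
Definition selected x N : {set 'I_n} := Sof (trace x N).

Lemma Sof_rcons (h : seq ('I_n * R * bool)) i t b :
  Sof (rcons h (i, t, b)) = if b then i |: Sof h else Sof h.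
Proof.
apply/setP => j; rewrite inE has_rcons /=; case: b; rewrite !inE ?andbF //.
by rewrite andbT eq_sym.
Qed.

Lemma selected0 x : selected x 0 = set0.
Proof. by apply/setP => i; rewrite !inE. Qed.

Lemma selectedS x N :
  selected x N.+1 = selected x N \/
  exists i t, [/\ A (trace x N) = Some (i, t), t <= x i, i \notin selected x N,
    selected x N.+1 \in F & selected x N.+1 = i |: selected x N].
Proof.
rewrite /selected /trace iterS -/(trace x N) /sstep.
case E : (A (trace x N)) => [[i t]|]; last by left.
case: ifPn => [/andP[iN iF]|]; last by left.
rewrite Sof_rcons; case: ifP => tx; last by left.
by right; exists i, t; split.
Qed.

Lemma selected_in x N : selected x N \in F.
Proof.
elim: N => [|N IH]; first by rewrite selected0.
by case: (selectedS x N) => [->//|[i [t []]]].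
Qed.

Lemma selected_mono x N N' : (N <= N')%N -> selected x N \subset selected x N'.
Proof.
elim: N' => [|N' IH]; first by rewrite leqn0 => /eqP ->.
rewrite leq_eqVlt => /orP[/eqP -> //|]; rewrite ltnS => /IH /subset_trans; apply.
by case: (selectedS x N') => [->//|[i [t [_ _ _ _ ->]]]]; exact: subsetUr.
Qed.

Lemma selected_final x N : selected x N \subset final_set F x A.
Proof. by apply/subsetP => i iN; rewrite inE; apply/asboolP; exists N. Qed.

(** Each of the finitely many items enters after some number of steps; the maximum of these numbers
    suffices, as the selection only grows. *)
Lemma final_set_reached x : exists N, final_set F x A = selected x N.
Proof.
have /choice [N NP] i : exists N, i \in final_set F x A -> i \in selected x N.
  case: (boolP (i \in final_set F x A)) => [|_]; last by exists 0.
  by rewrite inE => /asboolP [N iN]; exists N.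
exists (\max_i N i); apply/eqP; rewrite eqEsubset selected_final andbT.
apply/subsetP => i /NP; apply/subsetP; exact/selected_mono/leq_bigmax.
Qed.

Lemma final_set_in x : final_set F x A \in F.
Proof. by have [N ->] := final_set_reached x; exact: selected_in. Qed.

(* Lowering the values of items that [u] never selects leaves the run unchanged:
   their queries were rejected already. *)
Lemma trace_agree x u N : (forall i, x i <= u i) ->
  (forall i, i \in selected u N -> x i = u i) -> trace x N = trace u N.
Proof.
move=> xu; elim: N => [//|N IH] xE.
have {}IH : trace x N = trace u N.
  by apply: IH => i iN; apply: xE; apply: (subsetP (selected_mono u (leqnSn N))).
move: xE; rewrite /selected /trace !iterS -!/(trace _ N) IH /sstep.
case: (A (trace u N)) => [[i t]|] //; case: ifP => // _ xE; congr rcons; congr pair.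
have [tu|ut] := leP t (u i); last by apply/negbTE; rewrite -ltNge (le_lt_trans (xu i)).
by rewrite xE // Sof_rcons tu setU11.
Qed.

Lemma final_set_agree x u : (forall i, x i <= u i) ->
  (forall i, i \in final_set F u A -> x i = u i) -> final_set F x A = final_set F u A.
Proof.
move=> xu xE; apply/setP => i; rewrite !inE; apply: asbool_equiv_eq.
have tE N : trace x N = trace u N.
  apply: trace_agree => // j jN; apply: xE; exact: (subsetP (selected_final u N)).
by split=> -[N iN]; exists N; move: iN; rewrite -/(trace x N) -/(trace u N) tE.
Qed.

End SemiOnlineRuns.

(** * The simulating policy and its potential *)

Section Simulation.
Variables (R : realType) (n : nat) (F : {set {set 'I_n}}) (M : 'I_n -> mdp R).
Hypothesis F0 : set0 \in F.
Hypothesis wfM : wf_instance M.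
Variable pi : forall i, st (M i) -> act (M i) -> R.
Hypothesis piP : commitment pi.
Variables (D : forall i, st (M i) -> fdist R) (sigma : forall i, st (M i) -> R).
Hypothesis DP : surrogates pi D sigma.
Variable A : salg R n.
Implicit Types (h : seq (Defs.step M)).

(** The fold carries the current state along with the cap, since the update needs the index of the
    state being left. *)
Definition capped_state h : forall i, st (M i) * R :=
  foldl (fun (f : forall i, st (M i) * R) (e : Defs.step M) =>
           let i := projT1 e in
           dfwith f (i := i) ((projT2 e).2, Num.min (f i).2 (sigma (f i).1)))
        (fun i => (Defs.root (M i), sigma (Defs.root (M i)))) h.

(* [cap h i] is the least index among the states that [M i] has already left; the
   index of the root, harmless as an initial cap, stands for the empty minimum.
   [level h i] bounds the surrogate value of [M i] given [h]. *)
Definition cap h i : R := (capped_state h i).2.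
Definition level h i : R := Num.min (cap h i) (sigma (cur h i)).

Lemma capped_state_snoc h i (a : act (M i)) s' :
  capped_state (snoc h i a s') = dfwith (capped_state h)
    (s', Num.min (capped_state h i).2 (sigma (capped_state h i).1)).
Proof. by rewrite /capped_state -cats1 foldl_cat. Qed.

Lemma capped_state1 h i : (capped_state h i).1 = cur h i.
Proof.
elim/last_ind: h i => [//|h [j [a s']] IH] i.
rewrite capped_state_snoc cur_snoc.
have [<-|ji] := eqVneq j i; first by rewrite !dfwith_in.
by rewrite !dfwith_out.
Qed.

Lemma cap_in h i (a : act (M i)) s' : cap (snoc h i a s') i = level h i.
Proof. by rewrite /cap capped_state_snoc dfwith_in /= capped_state1. Qed.

Lemma cap_out h i (a : act (M i)) s' j : i != j -> cap (snoc h i a s') j = cap h j.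
Proof. by move=> ij; rewrite /cap capped_state_snoc dfwith_out. Qed.

Lemma level_out h i (a : act (M i)) s' j : i != j ->
  level (snoc h i a s') j = level h j.
Proof. by move=> ij; rewrite /level cap_out // cur_out. Qed.

Lemma level_in h i (a : act (M i)) s' :
  level (snoc h i a s') i = Num.min (level h i) (sigma s').
Proof. by rewrite /level cap_in cur_in. Qed.

(** The common grid: it contains all caps and surrogate values and is closed under minima. *)
Definition indices : seq R :=
  undup [seq sigma (tagged p) | p <- enum {: {i : 'I_n & st (M i)}}].

Lemma sigma_indices i (s : st (M i)) : sigma s \in indices.
Proof.
rewrite mem_undup; apply/mapP.
by exists (Tagged (fun i => Finite.sort (st (M i))) s); rewrite ?mem_enum.
Qed.

Lemma min_indices x y : x \in indices -> y \in indices -> Num.min x y \in indices.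
Proof. by move=> xZ yZ; case: leP. Qed.

Lemma cap_indices h i : cap h i \in indices.
Proof.
elim/last_ind: h i => [|h [j [a s']] IH] i; first exact: sigma_indices.
have [<-|ji] := eqVneq j i; last by rewrite cap_out.
by rewrite cap_in min_indices ?sigma_indices.
Qed.

Lemma surr_indices i (s : st (M i)) e : e \in D s -> e.1 \in indices.
Proof. by move=> /(surr_range (DP s)) [s' ->]; exact: sigma_indices. Qed.

(* What the simulation does next: advance the first item that the algorithm
   selects on input [level h] while its chain is unfinished, or halt. *)
Definition decision_spec h (d : option 'I_n * {set 'I_n}) : Prop :=
  match d.1 with
  | None => d.2 = final_set F (level h) A /\ forall i, i \in d.2 -> terminal (cur h i)
  | Some i => exists N t, [/\ ~~ terminal (cur h i),
      A (trace F A (level h) N) = Some (i, t), t <= level h i,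
      (forall j, j \in selected F A (level h) N -> terminal (cur h j)) &
      i \notin selected F A (level h) N /\
      d.2 = selected F A (level h) N.+1 /\ d.2 = i |: selected F A (level h) N]
  end.

(** Run the algorithm on [level h] up to the first step after which an unfinished chain is selected;
    the item added by that step is the one to advance. *)
Lemma decision_exists h : exists d, decision_spec h d.
Proof.
case: (boolP [forall i in final_set F (level h) A, terminal (cur h i)]).
  by move=> /forall_inP tG; exists (None, final_set F (level h) A).
move=> /forall_inPn [i0 i0G i0t].
have [N0 N0E] := final_set_reached F A (level h).
have exN : exists N, [exists i in selected F A (level h) N, ~~ terminal (cur h i)].
  by exists N0; apply/exists_inP; exists i0; rewrite // -N0E.
case: (ex_minnP exN) => N /exists_inP [i iN it] Nmin.
case: N iN Nmin => [|N] iN Nmin; first by rewrite selected0 inE in iN.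
have tN j : j \in selected F A (level h) N -> terminal (cur h j).
  move=> jN; apply: contraT => jt.
  suff /Nmin : [exists i in selected F A (level h) N, ~~ terminal (cur h i)].
    by rewrite ltnn.
  by apply/exists_inP; exists j.
case: (selectedS F A (level h) N) => [E|[j [t [At tx jN jF E]]]].
  by rewrite E in iN; rewrite tN in it.
have ij : i = j.
  by move: iN; rewrite E in_setU1 => /orP[/eqP //|/tN]; rewrite (negbTE it).
by exists (Some i, selected F A (level h) N.+1), N, t; rewrite ij in it *; split.
Qed.

Definition decision h := projT1 (cid (decision_exists h)).
Lemma decisionP h : decision_spec h (decision h).
Proof. exact: projT2 (cid _). Qed.

Definition simulation : policy M :=
  Policy (fun h S => (((decision h).1 == None) && (S == (decision h).2))%:R)
         (fun h i a => ((decision h).1 == Some i)%:R * pi (cur h i) a).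

Lemma decision_nonterminal h i : (decision h).1 = Some i -> ~~ terminal (cur h i).
Proof. by have := decisionP h; rewrite /decision_spec => + E; rewrite E => -[N [t []]]. Qed.

Lemma simulation_valid : valid_policy F simulation.
Proof.
split; first by move=> h S; exact: ler0n.
split.
  move=> h i a /=; case: eqP => [/decision_nonterminal/piP [p0 _]|_]; last by rewrite mul0r.
  by rewrite mul1r.
split.
  move=> h /=; case E : (decision h).1 => [i|] /=.
    rewrite big1 // add0r (bigD1 i) //= eqxx [X in _ + X]big1 ?addr0; last first.
      move=> j ji; rewrite big1 // => a _.
      by rewrite (inj_eq (@Some_inj _)) eq_sym (negbTE ji) mul0r.
    have [_ [_ p1]] := piP (decision_nonterminal E).
    by rewrite -mulr_sumr mul1r.
  rewrite [X in _ + X]big1 ?addr0; last by move=> i _; rewrite big1 // => a _; rewrite mul0r.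
  rewrite (bigD1 (decision h).2) //= eqxx big1 ?addr0 // => S.
  by move=> /negbTE ->.
split.
  move=> h S /=; case: eqP => [E|]; rewrite /= ?ltxx //; case: eqP => [->|]; rewrite ?ltxx // => _.
  have := decisionP h; rewrite /decision_spec E => -[DE tD]; split=> //.
  by rewrite DE; exact: final_set_in.
move=> h i a /=; case: eqP => [/decision_nonterminal/piP [_ [pa _]]|_].
  by rewrite mul1r; exact: pa.
by rewrite mul0r ltxx.
Qed.

Lemma simulation_committing : committing simulation.
Proof.
exists pi; split=> // h i a /=; case: eqP => [/decision_nonterminal/piP [_ [_ p1]]|_].
  by rewrite -mulr_sumr p1 !mul1r.
by rewrite mul0r -mulr_sumr !mul0r.
Qed.

Definition value x : R := \sum_(i in final_set F x A) x i.

(** Mass function of the surrogate value of a chain that is now at [s] with cap [m]. *)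
Definition law i (s : st (M i)) (m z : R) : R :=
  fexp (D s) (fun y => (Num.min m y == z)%R%:R).

Lemma law_sum1 i (s : st (M i)) m : m \in indices -> \sum_(z <- indices) law s m z = 1.
Proof.
move=> mZ; rewrite /law /fexp exchange_big -[RHS](fexp_cst 1 (surr_fdist (DP s))).
apply: eq_big_seq => e eD /=; rewrite -mulr_sumr; congr (_ * _).
have eZ : Num.min m e.1 \in indices by rewrite min_indices ?(surr_indices eD).
rewrite (bigD1_seq (Num.min m e.1)) ?undup_uniq //= eqxx big1 ?addr0 // => z.
by rewrite eq_sym => /negbTE ->.
Qed.

Lemma law_step i (s : st (M i)) m z : ~~ terminal s ->
  law s m z = \sum_s' chain_trans pi s s' * law s' (Num.min m (sigma s)) z.
Proof.
move=> st; rewrite /law (surr_step (DP s) st); apply: eq_bigr => s' _; congr (_ * _).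
by apply: eq_fexp => e _; rewrite minA.
Qed.

(** Exact amortization: the term subtracted in [pos_min] has expectation [chain_cost pi s] by the
    choice of the index, so the excess over the running cap, net of cost, is conserved. *)
Lemma excess_step i (s : st (M i)) m : ~~ terminal s ->
  excess (D s) m = \sum_s' chain_trans pi s s' * excess (D s') (Num.min m (sigma s))
    - chain_cost pi s.
Proof.
move=> st; rewrite /excess (surr_step (DP s) st) -(surr_cost (DP s) st) -sumrB.
apply: eq_bigr => s' _; rewrite -mulrBr -fexpB; congr (_ * _).
by apply: eq_fexp => e _; rewrite pos_min.
Qed.

Lemma law_support i (s : st (M i)) m z : law s m z != 0 ->
  exists2 e, e \in D s & z = Num.min m e.1.
Proof.
move=> lz; have [/hasP[e eD /eqP <-]|/hasPn nz] :=
    boolP (has (fun e => Num.min m e.1 == z) (D s)); first by exists e.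
by move: lz; rewrite /law fexp0 ?eqxx // => e /nz /negbTE ->.
Qed.

(** Conditional expectation, given [h], of what the algorithm earns on surrogate values, plus the
    excess over the caps still due from the items of the current decision. *)
Definition potential h : R :=
  grid_exp indices (fun i => law (cur h i) (cap h i)) value +
  \sum_(i in (decision h).2) excess (D (cur h i)) (cap h i).

(** The selected chains are finished, so their surrogate values equal their levels and all inputs in
    the support lead to the same selection. Level plus excess over the cap is the terminal value. *)
Lemma potential_halt h : (decision h).1 = None ->
  potential h = \sum_(i in (decision h).2) Defs.tval (cur h i).
Proof.
move=> E; have := decisionP h; rewrite /decision_spec E => -[DE tD].
rewrite /potential (@grid_exp_cst _ _ _ _ _ (\sum_(i in (decision h).2) level h i)).
- rewrite -big_split; apply: eq_bigr => i /tD ti /=.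
  rewrite (excess_terminal DP) // /level; have [_ ->] := surr_term (DP _) ti.
  case: (leP (cap h i) (Defs.tval (cur h i))) => [cv|vc].
    by rewrite pos_id ?subr_ge0 // addrC subrK.
  by rewrite pos_eq0 ?addr0 // subr_le0 ltW.
- by move=> i; apply: law_sum1; exact: cap_indices.
move=> x xP; have xl i : x i <= level h i.
  have [e eD ->] := law_support (xP i).
  by rewrite /level le_min !ge_min lexx (surr_le (DP _) eD) orbT.
have xE i : i \in final_set F (level h) A -> x i = level h i.
  rewrite -DE => /tD ti; have [e + ->] := law_support (xP i).
  by rewrite /level; have [-> ->] := surr_term (DP _) ti; rewrite inE => /eqP ->.
rewrite /value (final_set_agree xl xE) DE.
by apply: eq_bigr => i /xE.
Qed.

(** The potential after [M i] has moved to [s'], still evaluated with the set decided before the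
    move. *)
Definition advanced_potential h i (s' : st (M i)) : R :=
  grid_exp indices (fun j => if j == i then law s' (level h i)
                             else law (cur h j) (cap h j)) value +
  (\sum_(j in (decision h).2 | j != i) excess (D (cur h j)) (cap h j) +
   excess (D s') (level h i)).

Lemma potential_advance h i : (decision h).1 = Some i ->
  potential h = \sum_s' chain_trans pi (cur h i) s' * advanced_potential h s'
    - chain_cost pi (cur h i).
Proof.
move=> E; have nt := decision_nonterminal E.
have := decisionP h; rewrite /decision_spec E => -[N [t [_ _ _ _ [iN [_ DE]]]]].
have iD : i \in (decision h).2 by rewrite DE setU11.
rewrite /potential (bigD1 i) //= excess_step // -/(level h i).
rewrite (grid_exp_mix (i := i) (w := chain_trans pi (cur h i)) _
  (mu' := fun s' j => if j == i then law s' (level h i) else law (cur h j) (cap h j))).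
- rewrite /advanced_potential; under [in RHS]eq_bigr do rewrite !mulrDr.
  rewrite !big_split /= -mulr_suml chain_trans_sum1 // mul1r; ring.
- by move=> s' j z /negbTE ->.
- by move=> z; rewrite eqxx law_step.
Qed.

(** Updating the decision loses nothing. The items selected before [i] stay selected, and [i] can
    drop out only when its excess over the cap is zero. *)
Lemma advanced_potential_le h i (a : act (M i)) s' : (decision h).1 = Some i ->
  advanced_potential h s' <= potential (snoc h i a s').
Proof.
move=> E; have nt := decision_nonterminal E.
have := decisionP h; rewrite /decision_spec E => -[N [t [_ At tl tN [iN [DE DE']]]]].
set h' := snoc h i a s'.
have lvl_le j : level h' j <= level h j.
  have [<-|ij] := eqVneq i j; last by rewrite level_out.
  by rewrite level_in ge_min lexx.
have iNj j : j \in selected F A (level h) N -> i != j.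
  by move=> jN; apply: contraNneq iN => ->.
have trE : trace F A (level h') N = trace F A (level h) N.
  by apply: trace_agree => // j /iNj ij; rewrite level_out.
have tN' j : j \in selected F A (level h') N -> terminal (cur h' j).
  rewrite /selected trE -/(selected F A (level h) N) => jN.
  by rewrite cur_out ?tN ?iNj.
(* The first [N] steps repeat the old run and select only finished chains, so the new decision is
   not taken before step [N.+1]. *)
have sub : selected F A (level h') N.+1 \subset (decision h').2.
  have := decisionP h'; rewrite /decision_spec.
  case: (decision h').1 => [i'|]; last by case=> -> _; exact: selected_final.
  case=> N' [t' [nt' _ _ _ [_ [DE1 DE2]]]]; rewrite DE1; apply: selected_mono.
  rewrite ltnNge; apply/negP => /(selected_mono F A (level h')) /subsetP /(_ i').
  by rewrite -DE1 DE2 setU11 => /(_ isT) /tN'; rewrite (negbTE nt').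
(* If [i] is rejected, then [sigma s' < t <= level h i], and [sigma s'] bounds all atoms of
   [D s']. *)
have exc0 : i \notin (decision h').2 -> excess (D s') (level h i) = 0.
  move=> iD; apply: excess_eq0 => e /(surr_le (DP s')) /le_trans; apply.
  apply: (le_trans _ tl); apply: ltW; rewrite ltNge; apply: contra iD => ts.
  apply: (subsetP sub); rewrite /selected /trace iterS -/(trace _ _ _ N) trE /sstep At.
  rewrite -/(selected F A (level h) N) iN -DE' DE selected_in //=.
  by rewrite Sof_rcons level_in le_min tl ts setU11.
have rest : \sum_(j in (decision h).2 | j != i) excess (D (cur h j)) (cap h j) <=
    \sum_(j in (decision h').2 | j != i) excess (D (cur h' j)) (cap h' j).
  rewrite big_mkcond [leRHS]big_mkcond; apply: ler_sum => j _.
  case: (eqVneq j i) => [_|ji]; rewrite ?andbF // !andbT.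
  have exc_ge0 : 0 <= excess (D (cur h' j)) (cap h' j).
    by apply: excess_ge0; exact: surr_fdist (DP _).
  case: ifP => [|_]; last by case: ifP.
  rewrite DE' in_setU1 (negbTE ji) /= => jN.
  rewrite (subsetP sub) ?cur_out ?cap_out 1?eq_sym //.
  by apply: (subsetP (selected_mono F A _ (leqnSn N))); rewrite /selected trE.
rewrite /advanced_potential /potential; apply: lerD.
  rewrite le_eqVlt; apply/orP; left; apply/eqP; apply: eq_grid_exp => j z.
  have [->|ji] := eqVneq j i; first by rewrite cur_in cap_in.
  by rewrite cur_out ?cap_out // eq_sym.
have [iD|iD] := boolP (i \in (decision h').2).
  by rewrite [leRHS](bigD1 i) //= cur_in cap_in [leLHS]addrC lerD2l.
rewrite exc0 // addr0; apply: le_trans rest _; rewrite le_eqVlt; apply/orP; left.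
apply/eqP/eq_bigl => j; case: eqVneq => [->|]; last by rewrite andbT.
by rewrite (negbTE iD).
Qed.

(** The potential is dominated by the expected continuation at each advance and by the collected
    value at a halt. The ranks bound the number of advances left, so the fuel never cuts a run
    off. *)
Lemma simulation_ge_potential k h : (\sum_(i < n) rank (cur h i) <= k)%N ->
  potential h <= run_util simulation k h.
Proof.
elim: k h => [|k IH] h hk; case E : (decision h).1 => [i|].
- have : (0 < rank (cur h i))%N by apply/card_gt0P; exists (cur h i); rewrite inE connect0.
  by move: hk; rewrite (bigD1 i) //= leqn0 addn_eq0 -leqn0 => /andP[+ _]; case: rank.
- rewrite potential_halt //= E /= addr0 (bigD1 (decision h).2) //= eqxx mul1r lerDl.
  by rewrite sumr_ge0 // => S /negbTE ->; rewrite mul0r.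
- have nt := decision_nonterminal E; have [p0 [pa p1]] := piP nt.
  rewrite [leRHS]/= E /= big1 ?add0r; last by move=> S _; rewrite mul0r.
  rewrite (bigD1 i) //= eqxx [X in _ <= _ + X]big1 ?addr0; last first.
    move=> j ji; rewrite big1 // => a _.
    by rewrite (inj_eq (@Some_inj _)) eq_sym (negbTE ji) !mul0r.
  rewrite (potential_advance E).
  have -> : \sum_s' chain_trans pi (cur h i) s' * advanced_potential h s'
      - chain_cost pi (cur h i) = \sum_a pi (cur h i) a * (- cost (cur h i) a +
      \sum_s' trans (cur h i) a s' * advanced_potential h s').
    under [in RHS]eq_bigr do rewrite mulrDr mulrN mulr_sumr.
    rewrite big_split sumrN addrC /=; congr (_ + _).
    rewrite exchange_big; apply: eq_bigr => s' _; rewrite mulr_suml.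
    by apply: eq_bigr => a _; rewrite mulrA.
  apply: ler_sum => a _; rewrite mul1r.
  have [->|pn] := eqVneq (pi (cur h i) a) 0; first by rewrite !mul0r.
  have av : avail (cur h i) a by rewrite pa // lt_neqAle eq_sym pn p0.
  rewrite ler_wpM2l // lerD2l; apply: ler_sum => s' _.
  have [->|tn] := eqVneq (trans (cur h i) a s') 0; first by rewrite !mul0r.
  have t0 := trans_ge0 wfM s' av.
  rewrite ler_wpM2l //; apply: le_trans (advanced_potential_le a s' E) (IH _ _).
  rewrite -ltnS; apply: leq_trans hk; rewrite (bigD1 i) //= [X in (_ < X)%N](bigD1 i) //=.
  rewrite cur_in -addSn leq_add //.
    by apply: rank_lt => //; apply/existsP; exists a; rewrite av lt_neqAle eq_sym tn.
  by rewrite leq_sum // => j ji; rewrite cur_out // eq_sym.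
- rewrite potential_halt // [leRHS]/= E /= (bigD1 (decision h).2) //= eqxx mul1r.
  rewrite [X in _ <= _ + X]big1 ?addr0; last first.
    by move=> i _; rewrite big1 // => a _; rewrite !mul0r.
  rewrite lerDl.
  by rewrite sumr_ge0 // => S /negbTE ->; rewrite mul0r.
Qed.

Lemma Val_le_Util_simulation :
  Val F (fun i => D (Defs.root (M i))) A <= Util simulation.
Proof.
rewrite (@Val_grid _ _ indices); first last.
- by move=> i e; exact: surr_indices.
- exact: undup_uniq.
apply: le_trans (simulation_ge_potential (h := [::]) _); last first.
  by apply: leq_sum => i _; exact: max_card.
(* The initial cap is the index of the root, which already bounds the surrogate value, so capping
   leaves its law unchanged. *)
suff -> : grid_exp indices (fun i => Pmass (D (Defs.root (M i)))) value =
    grid_exp indices (fun i => law (cur [::] i) (cap [::] i)) value.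
  by rewrite lerDl; apply: sumr_ge0 => i _; apply: excess_ge0; exact: surr_fdist (DP _).
apply: eq_grid_exp => i z; rewrite PmassE; apply: eq_fexp => e /(surr_le (DP _)) es.
by rewrite (min_idPr es).
Qed.

End Simulation.

(** * The policy that halts at once with the empty set *)

Section HaltPolicy.
Variables (R : realType) (n : nat) (M : 'I_n -> mdp R).

Definition halt_policy : policy M :=
  Policy (fun _ S => (S == set0)%:R) (fun _ _ _ => 0).

Lemma halt_policy_valid (F : {set {set 'I_n}}) :
  set0 \in F -> valid_policy F halt_policy.
Proof.
move=> F0; split; first by move=> h S; exact: ler0n.
split; first by [].
split.
  move=> h /=; rewrite [X in _ + X]big1 ?addr0; last by move=> i _; rewrite big1.
  by rewrite (bigD1 set0) //= eqxx big1 ?addr0 // => S /negbTE ->.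
split; last by move=> h i a /=; rewrite ltxx.
by move=> h S /=; case: eqP => [-> _|_]; [split=> // i; rewrite inE|rewrite ltxx].
Qed.

Lemma halt_policy_committing : committing halt_policy.
Proof.
exists (@default_action _ _ M); split; first exact: default_actionP.
by move=> h i a; rewrite /= big1 ?mul0r.
Qed.

Lemma Util_halt_policy : Util halt_policy = 0.
Proof.
have E h : \sum_(S : {set 'I_n}) (S == set0)%:R * \sum_(i in S) Defs.tval (cur h i) = 0 :> R.
  by apply: big1 => S _; case: eqP => [->|_]; rewrite ?big_set0 ?mulr0 ?mul0r.
rewrite /Util; case: (\sum_(i < n) _)%N => [|k] /=; rewrite E add0r //.
by apply: big1 => i _; apply: big1 => a _; rewrite mul0r.
Qed.

End HaltPolicy.

Theorem theorem4 (R : realType) (n : nat) (F : {set {set 'I_n}}) (alpha : R)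
  (B : ('I_n -> fdist R) -> salg R n) :
  downward_closed F -> set0 \in F ->
  (forall D : 'I_n -> fdist R, (forall i, is_fdist (D i)) ->
     alpha^-1 * ExAnte F D <= Val F D (B D)) ->
  exists TB : forall M : 'I_n -> mdp R, policy M,
    forall M : 'I_n -> mdp R, wf_instance M ->
      valid_policy F (TB M) /\ committing (TB M) /\
      alpha^-1 * OPT F M <= Util (TB M).
Proof.
move=> _ F0 BP.
(* The map from instances to policies is obtained by choice from a pointwise statement. *)
suff H (M : 'I_n -> mdp R) : exists T : policy M, wf_instance M ->
    valid_policy F T /\ committing T /\ alpha^-1 * OPT F M <= Util T.
  by exists (fun M => projT1 (cid (H M))) => M; exact: projT2 (cid (H M)).
have [wfM|nwf] := EM (wf_instance M); last first.
  (* A placeholder value for ill-formed instances, about which nothing is claimed. *)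
  by exists (Policy (fun _ _ => 0) (fun _ _ _ => 0)) => /nwf.
(* A negative factor would reverse the comparison of [OPT] with [ExAnte]. In that case the target is
   nonpositive, since halting at once shows [0 <= OPT F M], and halting at once attains it. *)
have [alpha0|alpha_lt0] := leP 0 alpha^-1; last first.
  exists (@halt_policy _ _ M) => _; split; first exact: halt_policy_valid.
  split; first exact: halt_policy_committing.
  rewrite Util_halt_policy; apply: mulr_le0_ge0; first exact: ltW.
  by rewrite -(Util_halt_policy M); apply: Util_le_OPT => //; exact: halt_policy_valid.
have [T vT OPT_T] := OPT_attained F0 wfM.
pose pi := induced_commitment T (\sum_(i < n) #|{: st (M i)}|).
have piP : commitment pi := induced_commitmentP wfM vT _.
have [D [sigma DP]] := surrogates_exist wfM piP.
pose D0 i := D i (Defs.root (M i)).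
have D0P i : is_fdist (D0 i) := surr_fdist (DP _ _).
(* The algorithm is tuned to the surrogate laws at the roots, and the simulation plays the
   commitment induced by the optimal policy. *)
exists (simulation F pi sigma (B D0)) => _.
split; first exact: simulation_valid.
split; first exact: simulation_committing.
apply: le_trans (Val_le_Util_simulation F0 wfM piP DP (B D0)).
apply: le_trans (BP _ D0P); rewrite ler_wpM2l // OPT_T.
exact: run_util_le_ExAnte.
Qed.
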